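(* Let $d\geq 2$ and let $\gamma>-1$ be real. Let $U\subset\mathbb{R}^d$ be a small open ball centered on $\{0\}\times\mathbb{R}^{d-1}$ (i.e. with center a point of this hyperplane), and set $\Omega:=U\cap((0,\infty)\times\mathbb{R}^{d-1})$ and $\Gamma:=U\cap(\{0\}\times\mathbb{R}^{d-1})$. Then there is a positive constant $\delta$ such that, for any $\hat c>0$, any $b\in C^2(\Omega\cup\Gamma)$ with $\frac{\partial b}{\partial n}=0$ on $\Gamma$ and $|\nabla b|\leq\delta/\hat c$, $|\nabla^2 b|\leq\delta/\hat c^2$ in $\Omega$, and any $\chi\in C^3(\Omega\cup\Gamma)$ that solves the self-similar potential flow equation $$c^2\Delta\chi-\sum_{i,j=1}^d\chi_i\chi_j\chi_{ij} = |\nabla\chi|^2-d\,c^2\quad\text{in }\Omega$$ (with $c$ as in the context; if $\gamma=1$, $c=c_0$ for an arbitrary constant $c_0>0$), satisfies the slip condition $\frac{\partial\chi}{\partial n}=0$ on $\Gamma$, and has $L\leq1$, $\rho>0$ and $c\leq\hat c$ in $\Omega\cup\Gamma$, where $L=|\nabla\chi|/c$, either $$L^2\leq1-\delta\quad\text{in }\Omega\cup\Gamma,$$ or $L^2+b$ does not attain its maximum in $\Omega\cup\Gamma$.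
   Context: The functions are functions of $\vec\xi=(\xi^1,\dots,\xi^d)$ (similarity coordinates $\vec\xi=\vec x/t$), and subscripts denote partial derivatives: $\chi_i=\partial\chi/\partial\xi^i$, $\chi_{ij}=\partial^2\chi/\partial\xi^i\partial\xi^j$. $\nabla$, $\nabla^2$ and $\Delta$ denote gradient, Hessian and Laplacian in $\vec\xi$. $|\cdot|$ is the Euclidean norm on vectors and a fixed matrix norm (e.g. Frobenius) on Hessians. $\partial/\partial n$ is the derivative normal to the flat boundary part $\Gamma$, i.e. $\pm\partial/\partial\xi^1$. $C^k(\Omega\cup\Gamma)$ denotes functions that are $C^k$ in $\Omega$ with all derivatives of order $\le k$ extending continuously to $\Omega\cup\Gamma$. The sound speed $c>0$ is determined by $\chi$ via $$c^2=(1-\gamma)\left(\chi+\tfrac12|\nabla\chi|^2\right)\quad\text{if }\gamma\neq1,\qquad c=c_0\ \text{(a positive constant)}\quad\text{if }\gamma=1.$$ The density is $\rho=\pi^{-1}(-\chi-\frac12|\nabla\chi|^2)$, where, for positive constants $c_0,\rho_0$, $\pi(\rho)=\frac{c_0^2}{\gamma-1}(\rho/\rho_0)^{\gamma-1}$ if $\gamma\neq1$ and $\pi(\rho)=c_0^2\log(\rho/\rho_0)$ if $\gamma=1$. The condition $\rho>0$ means that $\rho$ is a well-defined positive number at every point; for $\gamma\ne1$ this means that $(1-\gamma)(\chi+\frac12|\nabla\chi|^2)>0$, so $c>0$, and for $\gamma=1$ it is automatic. The number $L:=|\nabla\chi|/c$ is the (local) pseudo-Mach number. *)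

(* Defs.v *)
From HB Require Import structures.
From mathcomp Require Import all_boot all_order all_algebra.
From mathcomp Require Import all_classical all_reals all_analysis.

Set Implicit Arguments.
Unset Strict Implicit.
Unset Printing Implicit Defensive.

Import Order.TTheory GRing.Theory Num.Theory.
Import numFieldNormedType.Exports.

Local Open Scope classical_set_scope.
Local Open Scope ring_scope.

(* Frobenius norm; on row vectors this is the Euclidean norm, whereas the
   library norm `|v| on 'rV[R]_d is the sup norm. *)
Definition frob (R : realType) (m n : nat) (A : 'M[R]_(m, n)) : R :=
  Num.sqrt (\sum_(i < m) \sum_(j < n) A i j ^+ 2).

Definition eball (R : realType) (d : nat) (a : 'rV[R]_d) (r : R) :
    set 'rV[R]_d :=
  [set x | frob (x - a) < r].

Definition half_dom (R : realType) (d : nat) (i0 : 'I_d) (U : set 'rV[R]_d) :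
    set 'rV[R]_d :=
  U `&` [set x | 0 < x 0 i0].

Definition flat_bdry (R : realType) (d : nat) (i0 : 'I_d) (U : set 'rV[R]_d) :
    set 'rV[R]_d :=
  U `&` [set x | x 0 i0 = 0].

(* At a point outside Omega (used only for boundary points) the value is the
   limit of the derivative from inside Omega, that is, the value of its
   continuous extension whenever there is one. *)
Definition pd (R : realType) (d : nat) (Omega : set 'rV[R]_d) (i : 'I_d)
    (f : 'rV[R]_d -> R) (x : 'rV[R]_d) : R :=
  if x \in Omega then 'D_(delta_mx 0 i) f x
  else lim ('D_(delta_mx 0 i) f y @[y --> within Omega (nbhs x)]).

(* f is C^k in the open set Omega, and all its derivatives of order <= k
   extend continuously to Omega `|` Gamma.  The continuity required of
   [pd Omega i f] forces the limits in its definition to exist on Gamma. *)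
Fixpoint Ck (R : realType) (d : nat) (Omega Gamma : set 'rV[R]_d) (k : nat)
    (f : 'rV[R]_d -> R) : Prop :=
  {within Omega `|` Gamma, continuous f} /\
  match k with
  | 0 => True
  | k'.+1 => forall i : 'I_d,
      (forall x, Omega x -> derivable f x (delta_mx 0 i)) /\
      Ck Omega Gamma k' (pd Omega i f)
  end.

Definition grad (R : realType) (d : nat) (Omega : set 'rV[R]_d)
    (f : 'rV[R]_d -> R) (x : 'rV[R]_d) : 'rV[R]_d :=
  \row_i pd Omega i f x.

Definition hess (R : realType) (d : nat) (Omega : set 'rV[R]_d)
    (f : 'rV[R]_d -> R) (x : 'rV[R]_d) : 'M[R]_d :=
  \matrix_(i, j) pd Omega i (pd Omega j f) x.

Definition laplacian (R : realType) (d : nat) (Omega : set 'rV[R]_d)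
    (f : 'rV[R]_d -> R) (x : 'rV[R]_d) : R :=
  \tr (hess Omega f x).

Definition sound_speed (R : realType) (d : nat) (Omega : set 'rV[R]_d)
    (gamma c0 : R) (chi : 'rV[R]_d -> R) (x : 'rV[R]_d) : R :=
  if gamma == 1 then c0
  else Num.sqrt
    ((1 - gamma) * (chi x + 2^-1 * frob (grad Omega chi x) ^+ 2)).

(* The function pi of the density; meaningful for r > 0. *)
Definition pi_fun (R : realType) (gamma c0 rho0 : R) (r : R) : R :=
  if gamma == 1 then c0 ^+ 2 * ln (r / rho0)
  else c0 ^+ 2 / (gamma - 1) * (r / rho0) `^ (gamma - 1).

(* rho x = pi^{-1} (- chi - |grad chi|^2 / 2) is well defined and positive. *)
Definition positive_density (R : realType) (d : nat) (Omega : set 'rV[R]_d)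
    (gamma c0 rho0 : R) (chi : 'rV[R]_d -> R) (x : 'rV[R]_d) : Prop :=
  exists2 rho : R, 0 < rho &
    pi_fun gamma c0 rho0 rho =
      - chi x - 2^-1 * frob (grad Omega chi x) ^+ 2.

Definition potential_flow (R : realType) (d : nat) (Omega : set 'rV[R]_d)
    (gamma c0 : R) (chi : 'rV[R]_d -> R) (x : 'rV[R]_d) : Prop :=
  let c := sound_speed Omega gamma c0 chi x in
  let g := grad Omega chi x in
  let H := hess Omega chi x in
  c ^+ 2 * laplacian Omega chi x
    - \sum_(i < d) \sum_(j < d) g 0 i * g 0 j * H i j
  = frob g ^+ 2 - d%:R * c ^+ 2.

Definition mach (R : realType) (d : nat) (Omega : set 'rV[R]_d)
    (gamma c0 : R) (chi : 'rV[R]_d -> R) (x : 'rV[R]_d) : R :=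
  frob (grad Omega chi x) / sound_speed Omega gamma c0 chi x.

Definition attains_max (R : realType) (T : Type) (W : set T) (F : T -> R) :
    Prop :=
  exists2 x, W x & forall y, W y -> F y <= F x.

(* Main.v *)
Require Import Defs.
From mathcomp Require Import all_boot all_order all_algebra.
From mathcomp Require Import all_classical all_reals all_analysis.
From mathcomp Require Import ring lra.

Set Implicit Arguments.
Unset Strict Implicit.
Unset Printing Implicit Defensive.

Import Order.TTheory GRing.Theory Num.Theory.
Import numFieldNormedType.Exports.

Local Open Scope classical_set_scope.
Local Open Scope ring_scope.

(** Write N = L^2, s = c^2, g = grad chi, H for the Hessian of chi and
    m = 1 - gamma, mu = 2 - m N.  The pseudo-Mach number satisfies an elliptic
    inequality: the flow equation has principal part A = s I - g g^T, which is
    positive semidefinite because L <= 1, and at every point where N + b is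
    critical the contraction of A with the Hessian of N + b is positive if b is
    flat enough.  A maximum of N + b is therefore impossible, inside the domain
    or on its flat boundary.

    The computation behind this is as follows.  In both cases of the definition
    of c one has grad s = m (g + H g), hence
      s grad N = mu H g - m N g,
    and at a critical point of N + b this equals - s grad b, so that g is an
    approximate eigenvector of H, with eigenvalue m N / mu.  The flow equation
    then gives the trace of H.  Third derivatives of chi enter the Hessian of N
    only through the derivatives of H in the direction g; contracted with A,
    they are given by the flow equation differentiated in the direction g.  The
    only remaining term of second order is mu |H|^2, bounded below through
    |H + I - l g g^T|^2 >= 0, where l = 2 / (mu s) makes this an equality in
    the extremal case L = 1.  For b = 0 the outcome is
      2 (d - N) + 4 N (1 - N) / mu >= 2 (d - 1),
    and for general b the error is at most a constant, depending on gamma and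
    d, times delta.  This is [scalar_contradiction] for the numbers involved
    and [jet_contradiction] for the derivatives at one point.

    On the other side, a maximum forces this contraction to be nonpositive
    ([max_critical], [contract_le0]).  At a boundary point only directions v
    that point into the domain can be tested, but that is enough: the second
    derivative in the direction v is even in v, and the directions that are not
    tangential are dense.  For the gradient one needs in addition that the
    normal derivative of N + b vanishes on the boundary.  It does: there
    chi_1 = 0, so its tangential derivatives chi_1j are zero
    ([tangential_partial0]), and both g and H g are tangential.  All identities
    hold inside by differentiation and extend to the boundary by continuity
    ([has_partials_eq0]). *)

(** * Directional derivatives *)

Lemma is_derive_line (R : realType) (V : normedModType R) (f : V -> R)
    (x v : V) (t D : R) :
  is_derive (x + t *: v) v f D ->
  is_derive t 1 (fun u : R => f (x + u *: v)) D.
Proof.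
have E : (fun h : R => h^-1 *: ((f \o shift (x + t *: v)) (h *: v) - f (x + t *: v)))
   = (fun h : R => h^-1 *: (((fun u : R => f (x + u *: v)) \o shift t) (h *: (1 : R)) -
      (fun u : R => f (x + u *: v)) t)).
  apply/funext => h /=; congr (_ *: (f _ - _)).
  by rewrite scalerDl /GRing.scale /= mulr1 addrCA.
case=> df <-; split; first by move: df; rewrite /derivable E.
by rewrite /derive -E.
Qed.

Lemma is_derive_dirZ (R : realType) (V : normedModType R) (f : V -> R)
    (x v : V) (k D : R) :
  is_derive x v f D -> is_derive x (k *: v) f (k * D).
Proof.
move=> [df <-].
have [->|k0] := eqVneq k 0; first by rewrite scale0r mul0r; exact: is_derive0.
have K : h^-1 *: ((f \o shift x) (h *: (k *: v)) - f x) @[h --> 0^'] --> k * 'D_v f x.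
  have E : (fun h : R => h^-1 *: ((f \o shift x) (h *: (k *: v)) - f x)) =
     (fun h : R => k *: ((h * k)^-1 *: ((f \o shift x) ((h * k) *: v) - f x))).
    apply/funext => h /=; rewrite !scalerA; congr (_ *: _).
    by rewrite invfM mulrCA divff // mulr1.
  rewrite E; apply: cvgZr.
  pose G := fun h : R => h^-1 *: ((f \o shift x) (h *: v) - f x).
  apply: (@cvg_comp _ _ _ (fun h : R => h * k) G _ (0:R)^' _ _ df).
  move=> A /= [e e0 He]; exists (e / `|k|); first by rewrite /= divr_gt0 ?normr_gt0.
  move=> h /= hh h0; apply: He => /=; last by rewrite mulf_neq0.
  move: hh; rewrite !sub0r !normrN normrM => hh.
  by rewrite -ltr_pdivlMr ?normr_gt0.
split; first by apply/cvg_ex; eexists; exact: K.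
exact/cvg_lim.
Qed.

(** The mean value theorem on a segment, along which [f] need only be
    differentiable in the direction of the segment. *)
Lemma MVT_dir (R : realType) (V : normedModType R) (f df : V -> R) (x v : V) :
  (forall t : R, 0 <= t <= 1 ->
     is_derive (x + t *: v) v f (df (x + t *: v))) ->
  exists2 t : R, 0 <= t <= 1 & f (x + v) - f x = df (x + t *: v).
Proof.
move=> H; pose phi (t : R) := f (x + t *: v).
have D (t : R) : 0 <= t <= 1 -> is_derive t 1 phi (df (x + t *: v)).
  by move=> /H; exact: is_derive_line.
have [||t t01] := @MVT_segment R phi (fun t : R => df (x + t *: v)) 0 1 ler01.
- by move=> t; rewrite in_itv /= => /andP[t0 t1]; apply: D; rewrite !ltW.
- apply: continuous_in_subspaceT => t; rewrite inE /= in_itv /= => t01.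
  apply: differentiable_continuous; apply/derivable1_diffP.
  by have [] := D t t01.
rewrite /phi scale1r scale0r addr0 subr0 mulr1 => ->.
by exists t => //; move: t01; rewrite in_itv.
Qed.

(** * Functions with continuous partial derivatives *)

(** Here [Om] is an open set and [W] is the union of [Om] with a part of its
    boundary.  The derivatives exist in [Om] only; on the rest of [W] the
    functions [df i] are the continuous extensions.  Continuity within [W]
    makes statements about interior and boundary points uniform. *)
Definition has_partials (R : realType) (d : nat) (Om W : set 'rV[R]_d)
    (f : 'rV[R]_d -> R) (df : 'I_d -> 'rV[R]_d -> R) : Prop :=
  [/\ forall x, W x -> f y @[y --> within W (nbhs x)] --> f x,
      forall i x, W x -> df i y @[y --> within W (nbhs x)] --> df i x
    & forall i x, Om x -> is_derive x (delta_mx 0 i) f (df i x)].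

Lemma near_cvg_within (R : realType) (V : normedModType R) (W : set V)
    (f : V -> R) (x : V) :
  f y @[y --> within W (nbhs x)] --> f x ->
  forall e, 0 < e -> \forall y \near x, W y -> `|f y - f x| < e.
Proof.
move=> /cvgrPdist_lt H e e0; move: (H e e0); rewrite near_withinE.
by apply: filterS => y H' /H'; rewrite distrC.
Qed.

Lemma row_norm_le (R : realType) (d : nat) (w : 'rV[R]_d) (c : R) :
  0 <= c -> (forall i, `|w 0 i| <= c) -> `|w| <= c.
Proof.
move=> c0 H; rewrite /Num.norm /= mx_normrE; apply: bigmax_le => // -[i j] _.
by rewrite ord1.
Qed.

Lemma le_row_norm (R : realType) (d : nat) (w : 'rV[R]_d) i : `|w 0 i| <= `|w|.
Proof.
rewrite [X in _ <= X]/Num.norm /= mx_normrE.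
by apply: le_trans (le_bigmax _ _ (0, i)).
Qed.

(** Continuous partial derivatives give derivatives in all directions: pass from
    [x] to [x + h *: v] one coordinate at a time and apply the mean value
    theorem to each step. *)
Lemma has_partials_dir (R : realType) (d : nat) (Om W : set 'rV[R]_d) f df
    (x v : 'rV[R]_d) :
  open Om -> Om `<=` W -> has_partials Om W f df -> Om x ->
  is_derive x v f (\sum_i v 0 i * df i x).
Proof.
move=> Oo OW [cf cdf Df] Ox.
set D := \sum_i _.
suff K : h^-1 *: ((f \o shift x) (h *: v) - f x) @[h --> 0^'] --> D.
  by split; [apply/cvg_ex; eexists; exact: K | exact/cvg_lim].
apply/cvgrPdist_le => e e0.
pose M := \sum_i `|v 0 i|.
have M0 : 0 <= M by apply: sumr_ge0.
pose e' := e / (M + 1).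
have e'0 : 0 < e' by rewrite divr_gt0 // ltr_wpDl.
have : \forall y \near x, Om y /\ forall i, `|df i y - df i x| < e'.
  have Hd := filter_forall (nbhs_filter x)
    (fun i => near_cvg_within (cdf i x (OW _ Ox)) e'0).
  have HO : \forall y \near x, Om y by exact: open_nbhs_nbhs.
  apply: filterS (filterI HO Hd) => y [Oy Hy]; split=> // i; apply: Hy.
  exact: OW.
move=> /nbhs_ballP[r /= r0 Hr].
exists (r / (`|v| + 1)); first by rewrite /= divr_gt0 // ltr_wpDl.
move=> h /=; rewrite sub0r normrN => hr h0.
have hv : `|h| * `|v| < r.
  rewrite (le_lt_trans (y := `|h| * (`|v| + 1))) //.
    by rewrite ler_wpM2l // lerDl.
  by rewrite -ltr_pdivlMr // ltr_wpDl.
(* [pre k] is [v] with all coordinates from the k-th on replaced by 0; the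
   segments from [x + h *: pre k] to [x + h *: pre k.+1] are parallel to the axes. *)
pose pre k : 'rV[R]_d := \row_i (if (i < k)%N then v 0 i else 0).
have preS (k : 'I_d) : pre k.+1 = pre k + v 0 k *: delta_mx 0 k.
  apply/rowP => i; rewrite !mxE /= ltnS leq_eqVlt.
  case: (eqVneq i k) => [->|ik]; first by rewrite eqxx ltnn /= mulr1 add0r.
  have -> : (nat_of_ord i == nat_of_ord k) = false by apply/negbTE.
  by rewrite mulr0 addr0.
have inball (w : 'rV[R]_d) : `|w| <= `|h| * `|v| ->
    Om (x + w) /\ forall i, `|df i (x + w) - df i x| < e'.
  move=> wv; apply: Hr; rewrite -ball_normE /= opprD addNKr normrN.
  exact: le_lt_trans wv hv.
have step (k : 'I_d) : `|f (x + h *: pre k.+1) - f (x + h *: pre k) -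
    h * (v 0 k * df k x)| <= `|h| * `|v 0 k| * e'.
  have Hz (t : R) : 0 <= t <= 1 ->
      `|h *: pre k + t *: ((h * v 0 k) *: delta_mx 0 k)| <= `|h| * `|v|.
    move=> /andP[t0 t1]; apply: row_norm_le; first by rewrite mulr_ge0.
    move=> i; rewrite !mxE /=.
    apply: (le_trans _ (ler_wpM2l (normr_ge0 h) (le_row_norm v i))).
    rewrite -normrM; case: (eqVneq i k) => [->|ik].
      rewrite ltnn mulr0 add0r ?eqxx mulr1 [`|t * _|]normrM (ger0_norm t0).
      by rewrite ler_piMl.
    by rewrite !mulr0 addr0; case: ifP => _ //; rewrite mulr0 normr0.
  have [|t t01] := @MVT_dir R _ f (fun y => h * v 0 k * df k y)
      (x + h *: pre k) ((h * v 0 k) *: delta_mx 0 k).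
    move=> t t01; apply: is_derive_dirZ; apply: Df.
    by rewrite -addrA; have [] := inball _ (Hz t t01).
  rewrite preS scalerDr [h *: (_ *: _)]scalerA addrA => ->.
  rewrite mulrA -mulrBr !normrM ler_wpM2l ?mulr_ge0 //.
  by rewrite -addrA; have [_ /(_ k) /ltW] := inball _ (Hz t t01).
have tele : f (x + h *: v) - f x =
    \sum_(k < d) (f (x + h *: pre k.+1) - f (x + h *: pre k)).
  rewrite -(big_mkord xpredT (fun k => f (x + h *: pre k.+1) - f (x + h *: pre k))).
  rewrite (telescope_sumr (fun k => f (x + h *: pre k))) //.
  congr (f _ - f _).
    by congr (_ + h *: _); apply/rowP => i; rewrite mxE ltn_ord.
  rewrite -[LHS]addr0; congr (_ + _); rewrite (_ : pre 0 = 0) ?scaler0 //.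
  by apply/rowP => i; rewrite !mxE.
rewrite /= [h *: v + x]addrC.
have -> : D - h^-1 *: (f (x + h *: v) - f x) =
   - (h^-1 * \sum_(k < d) (f (x + h *: pre k.+1) - f (x + h *: pre k) -
    h * (v 0 k * df k x))).
  rewrite sumrB -tele -mulr_sumr mulrBr mulKf // opprB.
  by rewrite /GRing.scale.
rewrite normrN normrM normfV ler_pdivrMl ?normr_gt0 //.
apply: (le_trans (ler_norm_sum _ _ _)).
apply: (le_trans (ler_sum _ (fun k _ => step k))).
rewrite -mulr_suml -mulr_sumr -mulrA ler_wpM2l // -/M /e'.
by rewrite mulrCA ger_pMr // ler_pdivrMr ?ltr_wpDl // mul1r lerDl.
Qed.

(** * One-sided limits along rays into a domain with a flat boundary *)

(** The mean value theorem on [0, t] for a function that is continuous from the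
    right at the end point 0, where it need not be differentiable. *)
Lemma MVT_right (R : realType) (phi psi : R -> R) (e : R) :
  (forall t : R, 0 < t < e -> is_derive t (1 : R) phi (psi t)) ->
  phi t @[t --> (0 : R)^'+] --> phi 0 ->
  forall t : R, 0 < t < e -> exists2 c, 0 < c < t & phi t - phi 0 = psi c * t.
Proof.
move=> D c0 t /andP[t0 te].
have Dt (u : R) : 0 < u <= t -> is_derive u (1 : R) phi (psi u).
  by move=> /andP[u0 ut]; apply: D; rewrite u0 (le_lt_trans ut).
have Ct u : 0 < u <= t -> {for u, continuous phi}.
  move=> ut; apply: differentiable_continuous; apply/derivable1_diffP.
  by have [] := Dt u ut.
have [||c ct] := @MVT R phi psi 0 t t0.
- by move=> u; rewrite in_itv /= => /andP[u0 ut]; apply: Dt; rewrite u0 ltW.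
- apply/continuous_within_itvP => //; split => //.
    by move=> u; rewrite in_itv /= => /andP[u0 ut]; apply: Ct; rewrite u0 ltW.
  by apply: cvg_at_left_filter; apply: Ct; rewrite t0 lexx.
by rewrite subr0 => ->; exists c => //; move: ct; rewrite in_itv.
Qed.

Lemma near_right0 (R : realType) (P : R -> Prop) :
  (\forall t \near (0 : R)^'+, P t) ->
  exists2 e : R, 0 < e & forall t : R, 0 < t < e -> P t.
Proof.
move=> [e /= e0 He]; exists e => // t /andP[t0 te]; apply: He => //=.
by rewrite sub0r normrN gtr0_norm.
Qed.

(** First-order condition at an end point: if the limit [a] of the derivative
    were positive, then by [MVT_right] the function would increase. *)
Lemma right_max_derive_le0 (R : realType) (phi psi : R -> R) (a : R) :
  (\forall t \near (0 : R)^'+, is_derive (t : R) (1 : R) phi (psi t)) ->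
  phi t @[t --> (0 : R)^'+] --> phi 0 -> psi t @[t --> (0 : R)^'+] --> a ->
  (\forall t \near (0 : R)^'+, phi t <= phi 0) -> a <= 0.
Proof.
move=> D c0 ca Hm; rewrite leNgt; apply/negP => a0.
have Hp : \forall t \near (0 : R)^'+, 0 < psi t by exact: (cvgr_gt a).
have [e e0 H] := near_right0 (filterI D (filterI Hm Hp)).
have [|c /andP[c0' ct]] := MVT_right (t := e / 2) (fun t ht => (H t ht).1) c0.
  by lra.
have [_ [+ _]] := H (e / 2) ltac:(lra).
have [_ [_ pc]] := H c ltac:(lra).
move=> h E; have : psi c * (e / 2) <= 0 by rewrite -E subr_le0.
by apply/negP; rewrite -ltNge mulr_gt0 // divr_gt0.
Qed.

(** Second-order condition at an end point with vanishing derivative, by two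
    applications of [MVT_right]. *)
Lemma right_max_derive2_le0 (R : realType) (phi psi om : R -> R) (a : R) :
  (\forall t \near (0 : R)^'+, is_derive (t : R) (1 : R) phi (psi t)) ->
  (\forall t \near (0 : R)^'+, is_derive (t : R) (1 : R) psi (om t)) ->
  phi t @[t --> (0 : R)^'+] --> phi 0 -> psi t @[t --> (0 : R)^'+] --> psi 0 ->
  om t @[t --> (0 : R)^'+] --> a -> psi 0 = 0 ->
  (\forall t \near (0 : R)^'+, phi t <= phi 0) -> a <= 0.
Proof.
move=> D D2 c0 cp ca p0 Hm; rewrite leNgt; apply/negP => a0.
have Hp : \forall t \near (0 : R)^'+, 0 < om t by exact: (cvgr_gt a).
have [e e0 H] := near_right0 (filterI D (filterI D2 (filterI Hm Hp))).
have [|c /andP[c0' ct] E] := MVT_right (t := e / 2) (fun t ht => (H t ht).1) c0.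
  by lra.
have [|c2 /andP[c20 c2t]] := MVT_right (t := c) (fun t ht => (H t ht).2.1) cp.
  by lra.
have [_ [_ [_ pc2]]] := H c2 ltac:(lra).
rewrite p0 subr0 => E2.
have [_ [_ [+ _]]] := H (e / 2) ltac:(lra).
rewrite -subr_le0 E E2; apply/negP; rewrite -ltNge.
by rewrite !mulr_gt0 // divr_gt0.
Qed.

Lemma cvg_sum_in (R : realType) (T : Type) (F : set_system T) (d : nat)
    (f : 'I_d -> T -> R) (a : 'I_d -> R) : Filter F ->
  (forall i, f i y @[y --> F] --> a i) ->
  \sum_i f i y @[y --> F] --> \sum_i a i.
Proof.
move=> FF H; apply: cvg_big => [|i _]; last exact: H.
exact: add_continuous.
Qed.

(** All that the proof uses of the half ball: its flat boundary lies in the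
    hyperplane where the coordinate [i0] is 0, and near a point of this boundary
    the domain is the positive side of the hyperplane. *)
Definition half_space_like (R : realType) (d : nat) (i0 : 'I_d)
    (Om Ga : set 'rV[R]_d) : Prop :=
  open Om /\ forall x, Ga x -> x 0 i0 = 0 /\
    \forall y \near x, (0 < (y : 'rV[R]_d) 0 i0 -> Om y) /\ (y 0 i0 = 0 -> Ga y).

Lemma ray_cvg (R : realType) (d : nat) (x v : 'rV[R]_d) :
  x + t *: v @[t --> (0 : R)^'+] --> x.
Proof.
apply: cvg_at_right_filter.
have : x + t *: v @[t --> (0 : R)] --> x + 0 *: v.
  by apply: cvgD; [exact: cvg_cst | apply: cvgZr_tmp; exact: cvg_id].
by rewrite scale0r addr0.
Qed.

Section half_space.
Context (R : realType) (d : nat) (i0 : 'I_d) (Om Ga : set 'rV[R]_d).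
Hypothesis hs : half_space_like i0 Om Ga.
Local Notation W := (Om `|` Ga).

(** Interior and boundary points are treated together: a direction is admissible
    at a boundary point if it points inward, and always at an interior point. *)
Lemma ray_in (x v : 'rV[R]_d) : W x -> (Ga x -> 0 < v 0 i0) ->
  \forall t \near (0 : R)^'+, Om (x + t *: v).
Proof.
case: hs => Oo Hg.
case=> [Ox _|Gx /(_ Gx) v0].
  have HO : nbhs x Om by exact: open_nbhs_nbhs.
  by have := @ray_cvg R d x v _ HO; rewrite nbhs_filterE.
have [x0 Hx] := Hg x Gx.
have := @ray_cvg R d x v _ Hx; rewrite nbhs_filterE => Hn.
have Hp : \forall t \near (0:R)^'+, 0 < t by exact: nbhs_right_gt.
apply: filterS (filterI Hp Hn) => t /= [t0 [+ _]]; apply.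
by rewrite !mxE x0 add0r mulr_gt0.
Qed.

Lemma ray_within (x v : 'rV[R]_d) (f : 'rV[R]_d -> R) : W x ->
  (Ga x -> 0 < v 0 i0) -> f y @[y --> within W (nbhs x)] --> f x ->
  f (x + t *: v) @[t --> (0 : R)^'+] --> f x.
Proof.
move=> Wx v0 cf.
apply: (@cvg_comp _ _ _ (fun t : R => x + t *: v) f _ (within W (nbhs x))) => //.
move=> A; rewrite /within /= nbhs_filterE /= => HA.
have H1 := @ray_cvg R d x v _ HA; rewrite nbhs_filterE in H1.
have H2 := ray_in Wx v0.
by apply: filterS (filterI H1 H2) => t /= [h o]; apply: h; left.
Qed.

(** Every point of the closure considered is reached along an admissible ray, so
    that inequalities between continuous functions pass to the boundary. *)
Lemma le0_closure (f : 'rV[R]_d -> R) (x : 'rV[R]_d) : W x ->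
  f y @[y --> within W (nbhs x)] --> f x ->
  (forall y, Om y -> f y <= 0) -> f x <= 0.
Proof.
move=> Wx cf H.
pose v : 'rV[R]_d := delta_mx 0 i0.
have v0 : Ga x -> 0 < v 0 i0 by rewrite mxE !eqxx.
have Hn : \forall t \near (0 : R)^'+, f (x + t *: v) <= 0.
  by apply: filterS (ray_in Wx v0) => t; exact: H.
exact: (closed_cvg (fun y : R => y <= 0) (@closed_le R 0) Hn _
  (ray_within Wx v0 cf)).
Qed.

Lemma eq0_closure (f : 'rV[R]_d -> R) (x : 'rV[R]_d) : W x ->
  f y @[y --> within W (nbhs x)] --> f x ->
  (forall y, Om y -> f y = 0) -> f x = 0.
Proof.
move=> Wx cf H; apply/eqP; rewrite eq_le; apply/andP; split.
  by apply: le0_closure cf _ => // y /H ->.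
rewrite -oppr_le0; apply: (@le0_closure (fun y => - f y)) => //.
  exact: cvgN.
by move=> y /H ->; rewrite oppr0.
Qed.

Lemma has_partials_ray F dF (x v : 'rV[R]_d) t : has_partials Om W F dF ->
  Om (x + t *: v) ->
  is_derive t 1 (fun t : R => F (x + t *: v)) (\sum_i v 0 i * dF i (x + t *: v)).
Proof.
move=> HF O; apply: is_derive_line.
have [Oo _] := hs.
by apply: has_partials_dir Oo _ HF O; left.
Qed.

Lemma max_inward_le0 F dF (x v : 'rV[R]_d) : has_partials Om W F dF -> W x ->
  (forall y, W y -> F y <= F x) -> (Ga x -> 0 < v 0 i0) ->
  \sum_i v 0 i * dF i x <= 0.
Proof.
move=> HF Wx Fx v0; have [cF cdF _] := HF.
apply: (@right_max_derive_le0 R (fun t : R => F (x + t *: v))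
  (fun t : R => \sum_i v 0 i * dF i (x + t *: v))).
- by apply: filterS (ray_in Wx v0) => t; exact: has_partials_ray.
- by rewrite scale0r addr0; apply: ray_within => //; exact: cF.
- apply: cvg_sum_in => i; apply: cvgM; first exact: cvg_cst.
  by apply: ray_within => //; exact: cdF.
- rewrite scale0r addr0.
  by apply: filterS (ray_in Wx v0) => t Ot; apply: Fx; left.
Qed.

Lemma max_inward2_le0 F dF ddF (x v : 'rV[R]_d) : has_partials Om W F dF ->
  (forall i, has_partials Om W (dF i) (ddF^~ i)) -> W x ->
  (forall y, W y -> F y <= F x) -> (forall i, dF i x = 0) ->
  (Ga x -> 0 < v 0 i0) ->
  \sum_i \sum_j v 0 i * v 0 j * ddF i j x <= 0.
Proof.
move=> HF HdF Wx Fx dFx v0; have [cF cdF _] := HF.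
have cdd i j : W x -> ddF i j y @[y --> within W (nbhs x)] --> ddF i j x.
  by have [_ + _] := HdF j; apply.
apply: (@right_max_derive2_le0 R (fun t : R => F (x + t *: v))
  (fun t : R => \sum_i v 0 i * dF i (x + t *: v))
  (fun t : R => \sum_i \sum_j v 0 i * v 0 j * ddF i j (x + t *: v))).
- by apply: filterS (ray_in Wx v0) => t; exact: has_partials_ray.
- apply: filterS (ray_in Wx v0) => t Ot.
  have := @is_derive_sum R _ _ d
    (fun j (t : R) => v 0 j * dF j (x + t *: v)) t 1
    (fun j => \sum_i v 0 i * v 0 j * ddF i j (x + t *: v)).
  rewrite exchange_big fct_sumE; apply => j.
  have := is_deriveZ (v 0 j) (has_partials_ray (HdF j) Ot).
  rewrite scaler_sumr => h; apply: (is_derive_eq h).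
  by apply: eq_bigr => i _; rewrite /GRing.scale /= mulrA [v 0 j * _]mulrC.
- by rewrite scale0r addr0; apply: ray_within => //; exact: cF.
- under [X in _ --> X]eq_bigr do rewrite scale0r addr0.
  apply: cvg_sum_in => i; apply: cvgM; first exact: cvg_cst.
  by apply: ray_within => //; exact: cdF.
- apply: cvg_sum_in => i; apply: cvg_sum_in => j; apply: cvgM; first exact: cvg_cst.
  by apply: ray_within => //; exact: cdd.
- by rewrite scale0r addr0; apply: big1 => i _; rewrite dFx mulr0.
- rewrite scale0r addr0.
  by apply: filterS (ray_in Wx v0) => t Ot; apply: Fx; left.
Qed.

End half_space.

(** * Symmetry of second derivatives and tangential derivatives on the boundary *)

Lemma is_derive_translate (R : realType) (V : normedModType R) (f : V -> R)
    (x w v : V) (D : R) :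
  is_derive (x + w) v f D -> is_derive x v (fun y => f (y + w)) D.
Proof.
have E : (fun h : R => h^-1 *: ((f \o shift (x + w)) (h *: v) - f (x + w)))
   = (fun h : R => h^-1 *: (((fun y => f (y + w)) \o shift x) (h *: v) -
      (fun y => f (y + w)) x)).
  by apply/funext => h /=; rewrite addrA.
case=> df <-; split; first by move: df; rewrite /derivable E.
by rewrite /derive -E.
Qed.

Lemma norm_delta2_le (R : realType) (d : nat) (i j : 'I_d) (a b : R) :
  `|a *: delta_mx 0 i + b *: delta_mx 0 j : 'rV[R]_d| <= `|a| + `|b|.
Proof.
have D (k : 'I_d) : `|delta_mx 0 k : 'rV[R]_d| <= 1.
  apply: row_norm_le => // l; rewrite mxE eqxx /=.
  by case: eqP => _; rewrite ?normr1 ?normr0.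
apply: (le_trans (ler_normD _ _)); rewrite !normrZ lerD //.
  by rewrite ler_piMr.
by rewrite ler_piMr.
Qed.

Section second_order.
Context (R : realType) (d : nat) (i0 : 'I_d) (Om Ga : set 'rV[R]_d).
Hypothesis hs : half_space_like i0 Om Ga.
Local Notation W := (Om `|` Ga).
Local Notation e i := (delta_mx 0 i : 'rV[R]_d).

(** The mixed second difference over a square of side [h], evaluated by applying
    the mean value theorem first in the direction [i], then in the direction
    [j]. *)
Lemma second_difference F dF ddF (x : 'rV[R]_d) (h : R) (i j : 'I_d) :
  has_partials Om W F dF -> (forall i, has_partials Om W (dF i) (ddF^~ i)) ->
  0 <= h ->
  (forall a b, 0 <= a <= h -> 0 <= b <= h -> Om (x + a *: e i + b *: e j)) ->
  exists ab : R * R, [/\ 0 <= ab.1 <= h, 0 <= ab.2 <= h &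
    F (x + h *: e i + h *: e j) - F (x + h *: e i) - (F (x + h *: e j) - F x)
    = h * (h * ddF j i (x + ab.1 *: e i + ab.2 *: e j))].
Proof.
move=> [_ _ DF] HdF h0 HO.
have hh : 0 <= h <= h by rewrite h0 lexx.
have scl (t : R) : 0 <= t <= 1 -> 0 <= t * h <= h.
  by move=> /andP[t0 t1]; rewrite mulr_ge0 // ler_piMl.
have [|t t01 E] := @MVT_dir R _ (fun y => F (y + h *: e j) - F y)
   (fun y => h * dF i (y + h *: e j) - h * dF i y) x (h *: e i).
  move=> t /scl th; rewrite scalerA; apply: is_deriveB.
    by apply: is_derive_translate; apply: is_derive_dirZ; apply/DF/HO.
  apply: is_derive_dirZ; apply: DF.
  by have := HO (t * h) 0 th; rewrite scale0r addr0 lexx; exact.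
rewrite E -mulrBr scalerA.
have [_ _ DdF] := HdF i.
have [|u u01 E2] := @MVT_dir R _ (dF i) (fun y => h * ddF j i y)
  (x + (t * h) *: e i) (h *: e j).
  move=> u /scl uh; rewrite scalerA; apply: is_derive_dirZ; apply: DdF.
  by apply: HO => //; exact: scl.
exists (t * h, u * h); split; rewrite /= ?scl //.
by rewrite E2 scalerA.
Qed.

(** The second difference of [second_difference] is symmetric in [i] and [j], so
    the two mixed derivatives take the same value, at two points arbitrarily
    close to [x]; continuity does the rest. *)
Lemma partials_sym F dF ddF (x : 'rV[R]_d) (i j : 'I_d) :
  has_partials Om W F dF -> (forall i, has_partials Om W (dF i) (ddF^~ i)) ->
  W x -> ddF i j x = ddF j i x.
Proof.
move=> HF HdF Wx.
have cdd k l y : W y -> ddF k l z @[z --> within W (nbhs y)] --> ddF k l y.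
  by have [_ + _] := HdF l; apply.
apply/eqP; rewrite -subr_eq0; apply/eqP.
apply: (eq0_closure hs Wx (f := fun y => ddF i j y - ddF j i y)).
  by apply: cvgB; exact: cdd.
move=> {Wx}{}x Ox; apply/eqP; case: eqP => // /eqP; rewrite -normr_gt0 => D0.
set D := `|_| in D0; have e0 : 0 < D / 2 by rewrite divr_gt0.
have Wx : W x by left.
have Oo : open Om by case: hs.
have HO : nbhs x Om by exact: open_nbhs_nbhs.
have N1 := near_cvg_within (cdd i j x Wx) e0.
have N2 := near_cvg_within (cdd j i x Wx) e0.
have : \forall y \near x, Om y /\
    (W y -> `|ddF i j y - ddF i j x| < D / 2) /\
    (W y -> `|ddF j i y - ddF j i x| < D / 2).
  by exact: filterI HO (filterI N1 N2).
move=> /nbhs_ballP[r /= r0 Hr].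
(* The two increments have length at most r / 3, so the square stays in the ball. *)
have inb a b k l : 0 <= a <= r / 3 -> 0 <= b <= r / 3 ->
    ball x r (x + a *: e k + b *: e l).
  move=> /andP[a0 ar] /andP[b0 br]; rewrite -ball_normE /= -addrA opprD addNKr.
  rewrite normrN; apply: le_lt_trans (norm_delta2_le _ _ _ _) _.
  by rewrite !ger0_norm //; lra.
have r3 : 0 <= r / 3 by lra.
have [|[a b] /= [ha hb E1]] := second_difference (x := x) (i := i) (j := j) HF HdF r3.
  by move=> a b ha hb; have [] := Hr _ (inb a b i j ha hb).
have [|[a' b'] /= [ha' hb' E2]] := second_difference (x := x) (i := j) (j := i) HF HdF r3.
  by move=> a1 b1 ha1 hb1; have [] := Hr _ (inb a1 b1 j i ha1 hb1).
have [oa [_ M1']] := Hr _ (inb a b i j ha hb); have M1 := M1' (or_introl oa).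
have [ob [M2' _]] := Hr _ (inb a' b' j i ha' hb'); have M2 := M2' (or_introl ob).
clear M1' M2'.
set p := ddF j i _ in E1 M1; set q := ddF i j _ in E2 M2.
have pq : q = p.
  have r30 : r / 3 != 0 by lra.
  apply: (mulfI r30); apply: (mulfI r30); rewrite -E1 -E2.
  by rewrite -!addrA [_ *: e j + _]addrC; lra.
suff : D < D by rewrite ltxx.
rewrite {1}/D.
rewrite (_ : ddF i j x - ddF j i x = (p - ddF j i x) - (q - ddF i j x)); last by rewrite pq; lra.
apply: le_lt_trans (ler_normB _ _) _; lra.
Qed.

(** [F] vanishes on the flat boundary, so its tangential derivatives should
    vanish there too; but they are known to be derivatives only inside.  The
    segment from [x] in the tangential direction [j] is therefore shifted inward
    by a small [t].  If the derivative were not 0, then [F] would change along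
    the shifted segment by an amount bounded below independently of [t], whereas
    its values at both ends tend to 0 with [t]. *)
Lemma tangential_partial0 F dF (x : 'rV[R]_d) (j : 'I_d) :
  has_partials Om W F dF -> (forall y, Ga y -> F y = 0) -> Ga x -> j != i0 ->
  dF j x = 0.
Proof.
move=> [cF cdF DF] F0 Gx ji; have Wx : W x by right.
apply/eqP; case: eqP => // /eqP; rewrite -normr_gt0 => D0.
set D := `|_| in D0; have e0 : 0 < D / 2 by rewrite divr_gt0.
have [_ Hg] := hs; have [x0 Hx] := Hg x Gx.
have N1 := near_cvg_within (cdF j x Wx) e0.
have : \forall y \near x,
    ((0 < (y : 'rV[R]_d) 0 i0 -> Om y) /\ (y 0 i0 = 0 -> Ga y)) /\
    (W y -> `|dF j y - dF j x| < D / 2).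
  by exact: filterI Hx N1.
move=> /nbhs_ballP[r /= r0 Hr].
pose h := r / 3; have h0 : 0 < h by rewrite /h; lra.
have inb a b : 0 <= a <= h -> 0 <= b <= h -> ball x r (x + a *: e i0 + b *: e j).
  move=> /andP[a0 ar] /andP[b0 br]; rewrite -ball_normE /= -addrA opprD addNKr.
  rewrite normrN; apply: le_lt_trans (norm_delta2_le _ _ _ _) _.
  by rewrite !ger0_norm //; rewrite /h in ar br *; lra.
have crd a b : (x + a *: e i0 + b *: e j) 0 i0 = a.
  by rewrite !mxE !eqxx eq_sym (negbTE ji) /= x0 mulr0 mulr1 addr0 add0r.
have hh : 0 <= h <= h by rewrite lexx ltW.
have z0h : 0 <= (0 : R) <= h by apply/andP; split; [exact: lexx | exact: ltW].
pose z := x + h *: e j.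
have Gz : Ga z.
  have [[_]] := Hr _ (inb 0 h z0h hh); rewrite crd scale0r addr0.
  by move=> /(_ erefl).
have Wz : W z by right.
pose c := h * D / 4; have c0 : 0 < c by rewrite divr_gt0 // mulr_gt0.
have v1 y : Ga y -> 0 < e i0 0 i0 by rewrite mxE !eqxx.
have Rx := ray_within hs Wx (v1 x) (cF x Wx).
have Rz := ray_within hs Wz (v1 z) (cF z Wz).
have Ex : \forall t \near (0 : R)^'+, `|F (x + t *: e i0)| < c.
  move/cvgrPdist_lt: Rx => /(_ c c0); apply: filterS => t.
  by rewrite F0 // sub0r normrN.
have Ez : \forall t \near (0 : R)^'+, `|F (z + t *: e i0)| < c.
  move/cvgrPdist_lt: Rz => /(_ c c0); apply: filterS => t.
  by rewrite F0 // sub0r normrN.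
have Eh : \forall t \near (0 : R)^'+, t < h by exact: nbhs_right_lt.
have [t0 t00 Ht] := near_right0 (filterI Ex (filterI Ez Eh)).
have [Fx [Fz th]] := Ht (t0 / 2) ltac:(lra).
set t := t0 / 2 in Fx Fz th; have tp : 0 < t by rewrite /t; lra.
have th' : 0 <= t <= h by rewrite !ltW.
have scl (u : R) : 0 <= u <= 1 -> 0 <= u * h <= h.
  by move=> /andP[u0 u1]; rewrite mulr_ge0 ?ler_piMl // ltW.
have [|u u01] := @MVT_dir R _ F (fun y => h * dF j y) (x + t *: e i0) (h *: e j).
  move=> u /scl uh; rewrite scalerA; apply: is_derive_dirZ; apply: DF.
  by have [[+ _] _] := Hr _ (inb t (u * h) th' uh); rewrite crd; apply.
rewrite scalerA; set y := x + t *: e i0 + (u * h) *: e j.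
have [[Oy _] My] := Hr _ (inb t (u * h) th' (scl u u01)).
have {}My : `|dF j y - dF j x| < D / 2 by apply: My; left; apply: Oy; rewrite crd.
have -> : x + t *: e i0 + h *: e j = z + t *: e i0 by rewrite /z addrAC.
move=> E.
have L1 : `|h * dF j y| < c + c.
  by rewrite -E; apply: le_lt_trans (ler_normB _ _) _; rewrite ltrD.
have L2 : D / 2 < `|dF j y|.
  have := ler_normB (dF j y) (dF j y - dF j x); rewrite subKr -/D; lra.
move: L1; rewrite normrM gtr0_norm // ltNge => /negP[].
have -> : c + c = h * (D / 2) by rewrite /c; field.
by rewrite ler_pM2l // ltW.
Qed.

End second_order.

(** * Necessary conditions at a maximum *)

Section maximum.
Context (R : realType) (d : nat) (i0 : 'I_d) (Om Ga : set 'rV[R]_d).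
Hypothesis hs : half_space_like i0 Om Ga.
Local Notation W := (Om `|` Ga).
Local Notation e i := (delta_mx 0 i : 'rV[R]_d).

Lemma sum_delta (f : 'I_d -> R) (i : 'I_d) :
  \sum_k (k == i)%:R * f k = f i.
Proof.
rewrite (bigD1 i) //= eqxx mul1r big1 ?addr0 // => k /negbTE ->.
by rewrite mul0r.
Qed.

(** At a boundary point the inequalities are available for the inward directions
    only, and they are extended to all directions by symmetry and density. *)
Lemma max_critical F dF ddF (x : 'rV[R]_d) :
  has_partials Om W F dF -> (forall i, has_partials Om W (dF i) (ddF^~ i)) ->
  W x -> (forall y, W y -> F y <= F x) -> (Ga x -> dF i0 x = 0) ->
  (forall i, dF i x = 0) /\
  forall v : 'rV[R]_d, \sum_i \sum_j v 0 i * v 0 j * ddF i j x <= 0.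
Proof.
move=> HF HdF Wx Fx dF0.
have H1 := max_inward_le0 hs HF Wx Fx.
have sum2 (a b : R) k l :
    \sum_i (a *: e k + b *: e l) 0 i * dF i x = a * dF k x + b * dF l x.
  under eq_bigr => i _ do rewrite !mxE eqxx /= mulrDl -!mulrA.
  by rewrite big_split /= -!mulr_sumr !sum_delta.
have {}dF0 : dF i0 x = 0.
  have [/dF0 //|nGx] := pselect (Ga x).
  have := H1 (1 *: e i0 + 0 *: e i0) (fun G => False_ind _ (nGx G)).
  have := H1 ((-1) *: e i0 + 0 *: e i0) (fun G => False_ind _ (nGx G)).
  rewrite !sum2; lra.
have dFx i : dF i x = 0.
  have [->//|ii0] := eqVneq i i0.
  have v0 (b : R) : Ga x -> 0 < (1 *: e i0 + b *: e i) 0 i0.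
    by move=> _; rewrite !mxE !eqxx eq_sym (negbTE ii0) /= mulr0 addr0 mulr1.
  (* The inward directions e_i0 + e_i and e_i0 - e_i give opposite inequalities,
     because the derivative along e_i0 is already known to vanish. *)
  have := H1 _ (v0 1); have := H1 _ (v0 (-1)); rewrite !sum2 dF0; lra.
split=> // v.
have H2 := max_inward2_le0 hs HF HdF Wx Fx dFx.
have [v0|v0|v0] := ltgtP (v 0 i0) 0.
- have := H2 (- v); rewrite mxE oppr_gt0 => /(_ (fun _ => v0)).
  by under eq_bigr do under eq_bigr do rewrite !mxE mulrNN.
- exact: H2.
(* A tangential direction is the limit of the inward directions v + t e_i0. *)
- pose Q (t : R) := \sum_i \sum_j (v + t *: e i0) 0 i * (v + t *: e i0) 0 j * ddF i j x.
  have cE i : (v + t *: e i0) 0 i @[t --> (0 : R)^'+] --> v 0 i.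
    apply: cvg_at_right_filter.
    have -> : (fun t : R => (v + t *: e i0) 0 i) =
        (fun t : R => v 0 i + t * e i0 0 i).
      by apply/funext => t; rewrite !mxE.
    have : v 0 i + t * e i0 0 i @[t --> (0 : R)] --> v 0 i + 0 * e i0 0 i.
      by apply: cvgD; [exact: cvg_cst | apply: cvgM; [exact: cvg_id | exact: cvg_cst]].
    by rewrite mul0r addr0.
  have cQ : Q t @[t --> (0 : R)^'+] --> \sum_i \sum_j v 0 i * v 0 j * ddF i j x.
    apply: cvg_sum_in => i; apply: cvg_sum_in => j.
    by apply: cvgM; [apply: cvgM; exact: cE | exact: cvg_cst].
  apply: (closed_cvg (fun y : R => y <= 0) (@closed_le R 0) _ _ cQ).
  have Hp : \forall t \near (0:R)^'+, 0 < t by exact: nbhs_right_gt.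
  apply: filterS Hp => t t0; apply: H2 => _.
  by rewrite !mxE !eqxx mulr1 v0 add0r.
Qed.

End maximum.

(** The contraction of [M] with the matrix s I - g g^T. *)
Definition contract (R : realType) (d : nat) (s : R) (g : 'I_d -> R)
    (M : 'I_d -> 'I_d -> R) : R :=
  s * \sum_i M i i - \sum_i \sum_j g i * g j * M i j.

(** The matrix s I - g g^T is s times the square of the symmetric matrix
    I - th g g^T, for a suitable number [th]; hence the contraction is s times
    the sum of the values of the quadratic form [M] at the rows of
    I - th g g^T. *)
Lemma contract_le0 (R : realType) (d : nat) (s : R) (g : 'I_d -> R) M :
  0 < s -> \sum_i g i ^+ 2 <= s ->
  (forall v : 'rV[R]_d, \sum_i \sum_j v 0 i * v 0 j * M i j <= 0) ->
  contract s g M <= 0.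
Proof.
move=> s0 Gs HM; set G := \sum_i _ in Gs.
pose sg := Num.sqrt (1 - G / s).
have sg2 : sg ^+ 2 = 1 - G / s by rewrite sqr_sqrtr // subr_ge0 ler_pdivrMr // mul1r.
have sg0 : 0 <= sg by exact: sqrtr_ge0.
(* The root of 2 th - th^2 G = 1 / s that stays finite for G = 0. *)
pose th := (s * (1 + sg))^-1.
have thE : 2 * th - th ^+ 2 * G = s^-1.
  have -> : G = s * (1 - sg ^+ 2) by rewrite sg2; field; lra.
  by rewrite /th; field; apply/andP; split; lra.
have Hk k : \sum_i \sum_j ((i == k)%:R - th * g k * g i) *
    ((j == k)%:R - th * g k * g j) * M i j <= 0.
  have := HM (\row_i ((i == k)%:R - th * g k * g i)).
  by under eq_bigr do under eq_bigr do rewrite !mxE.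
have := sumr_le0 (index_enum 'I_d) (fun k (_ : true) => Hk k).
rewrite exchange_big /=; under eq_bigr do rewrite exchange_big /=.
have E i j : \sum_k ((i == k)%:R - th * g k * g i) *
    ((j == k)%:R - th * g k * g j) * M i j =
    (i == j)%:R * M i j - s^-1 * (g i * g j * M i j).
  rewrite -mulr_suml -thE.
  have -> : \sum_k ((i == k)%:R - th * g k * g i) *
      ((j == k)%:R - th * g k * g j) =
      \sum_k ((k == i)%:R * (j == k)%:R - (k == i)%:R * (th * g k * g j)
    - (k == j)%:R * (th * g k * g i) + th ^+ 2 * g i * g j * (g k ^+ 2)).
    apply: eq_bigr => k _; rewrite [i == k]eq_sym [j == k]eq_sym.
    by ring.
  rewrite big_split /= !sumrB !sum_delta -mulr_sumr -/G [j == i]eq_sym.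
  by ring.
under eq_bigr do under eq_bigr do rewrite E.
rewrite /contract.
have -> : \sum_i \sum_j ((i == j)%:R * M i j - s^-1 * (g i * g j * M i j)) =
    s^-1 * (s * \sum_i M i i - \sum_i \sum_j g i * g j * M i j).
  rewrite mulrBr mulKf ?gt_eqF // mulr_sumr -sumrB; apply: eq_bigr => i _.
  rewrite sumrB mulr_sumr; congr (_ - _).
  by under eq_bigr do rewrite eq_sym; rewrite sum_delta.
by rewrite pmulr_rle0 // invr_gt0.
Qed.

(** * Contraction with the coefficient matrix of the flow equation *)

(** Cauchy-Schwarz with a weight: the terms are estimated one by one, and with
    the right [e] nothing is lost. *)
Lemma sum_mul_le (R : realType) (I : finType) (a b : I -> R) (e : R) :
  0 < e ->
  `|\sum_i a i * b i| <= (e * \sum_i a i ^+ 2 + e^-1 * \sum_i b i ^+ 2) / 2.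
Proof.
move=> e0; apply: (le_trans (ler_norm_sum _ _ _)).
rewrite !mulr_sumr -big_split /= mulr_suml; apply: ler_sum => i _.
rewrite normrM.
have : 0 <= (e * `|a i| - `|b i|) ^+ 2 / e by rewrite divr_ge0 ?sqr_ge0 // ltW.
rewrite -(real_normK (num_real (a i))) -(real_normK (num_real (b i))).
have -> : (e * `|a i| - `|b i|) ^+ 2 / e =
  e * `|a i| ^+ 2 + e^-1 * `|b i| ^+ 2 - 2 * (`|a i| * `|b i|).
  by field; lra.
lra.
Qed.

Section contraction.
Context (R : realType) (d : nat) (s : R) (g : 'I_d -> R).
Implicit Types M : 'I_d -> 'I_d -> R.

Lemma eq_contract M M' : (forall i j, M i j = M' i j) ->
  contract s g M = contract s g M'.
Proof.
move=> E; rewrite /contract; congr (_ * _ - _); first exact: eq_bigr.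
by apply: eq_bigr => i _; apply: eq_bigr => j _; rewrite E.
Qed.

Lemma contractD M M' :
  contract s g (fun i j => M i j + M' i j) = contract s g M + contract s g M'.
Proof.
rewrite /contract big_split /=.
have -> : \sum_i \sum_j g i * g j * (M i j + M' i j) =
    \sum_i \sum_j g i * g j * M i j + \sum_i \sum_j g i * g j * M' i j.
  rewrite -big_split; apply: eq_bigr => i _ /=; rewrite -big_split.
  by apply: eq_bigr => j _; rewrite mulrDr.
by ring.
Qed.

Lemma contractZ a M : contract s g (fun i j => a * M i j) = a * contract s g M.
Proof.
rewrite /contract -mulr_sumr mulrBr mulrCA; congr (_ - _).
rewrite mulr_sumr; apply: eq_bigr => i _; rewrite mulr_sumr.
by apply: eq_bigr => j _; rewrite mulrCA.
Qed.

Lemma contract_rank1 (a b : 'I_d -> R) :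
  contract s g (fun i j => a i * b j) =
  s * (\sum_i a i * b i) - (\sum_i g i * a i) * (\sum_i g i * b i).
Proof.
rewrite /contract; congr (_ - _); rewrite mulr_suml; apply: eq_bigr => i _.
by rewrite mulr_sumr; apply: eq_bigr => j _; ring.
Qed.

Lemma contract_sum (M : 'I_d -> 'I_d -> 'I_d -> R) :
  contract s g (fun i j => \sum_k M k i j) = \sum_k contract s g (M k).
Proof.
rewrite /contract sumrB -mulr_sumr; congr (_ * _ - _); first exact: exchange_big.
rewrite [RHS]exchange_big; apply: eq_bigr => i _ /=; rewrite [RHS]exchange_big.
by apply: eq_bigr => j _; rewrite mulr_sumr.
Qed.

(** The Frobenius norm of s I - g g^T is at most s times the square root of d; the
    product with the norm of [M] is split by [sum_mul_le]. *)
Lemma contract_ge M (e D : R) : 0 < s -> \sum_i g i ^+ 2 <= s -> 0 < e ->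
  \sum_i \sum_j M i j ^+ 2 <= D ->
  - ((e * (s ^+ 2 * d%:R) + e^-1 * D) / 2) <= contract s g M.
Proof.
move=> s0 Gs e0 MD; set G := \sum_i _ in Gs.
have G0 : 0 <= G by apply: sumr_ge0 => i _; exact: sqr_ge0.
have -> : contract s g M =
    \sum_ij (s * (ij.1 == ij.2)%:R - g ij.1 * g ij.2) * M ij.1 ij.2.
  rewrite -(pair_bigA _ (fun i j => (s * (i == j)%:R - g i * g j) * M i j)) /=.
  rewrite /contract mulr_sumr -sumrB; apply: eq_bigr => i _.
  under [RHS]eq_bigr do rewrite mulrBl.
  rewrite sumrB; congr (_ - _).
  under [RHS]eq_bigr do rewrite -mulrA eq_sym.
  by rewrite -mulr_sumr sum_delta.
have := sum_mul_le (fun ij => s * (ij.1 == ij.2)%:R - g ij.1 * g ij.2)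
  (fun ij => M ij.1 ij.2) e0.
rewrite ler_norml => /andP[+ _]; apply: le_trans; rewrite lerN2 ler_pM2r ?invr_gt0 //.
apply: lerD; last first.
  by rewrite ler_pM2l ?invr_gt0 // -(pair_bigA _ (fun i j => M i j ^+ 2)).
rewrite ler_pM2l //.
rewrite -(pair_bigA _ (fun i j => (s * (i == j)%:R - g i * g j) ^+ 2)) /=.
have E i : \sum_j (s * (i == j)%:R - g i * g j) ^+ 2 =
    s ^+ 2 - 2 * s * g i ^+ 2 + g i ^+ 2 * G.
  have -> : \sum_j (s * (i == j)%:R - g i * g j) ^+ 2 =
      \sum_j ((j == i)%:R * (s ^+ 2 - 2 * s * g i * g j) + g i ^+ 2 * (g j ^+ 2)).
    apply: eq_bigr => j _; rewrite eq_sym; case: eqP => _ /=; by ring.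
  rewrite big_split /= sum_delta -mulr_sumr -/G; ring.
under eq_bigr do rewrite E.
have -> : \sum_(i < d) (s ^+ 2 - 2 * s * g i ^+ 2 + g i ^+ 2 * G) =
    s ^+ 2 * d%:R - 2 * s * G + G * G.
  rewrite big_split sumrB /= sumr_const card_ord.
  by congr (_ - _ + _); rewrite ?mulr_natr -?mulr_sumr -?mulr_suml.
nra.
Qed.

(** This is |H + I - l g g^T|^2 >= 0, expanded.  Equality holds when H is - I on
    the complement of g and g is an eigenvector of H with the eigenvalue
    l |g|^2 - 1. *)
Lemma sum_sqr_hessian_ge (H : 'I_d -> 'I_d -> R) (l : R) :
  - d%:R - l ^+ 2 * (\sum_i g i ^+ 2) ^+ 2 - 2 * (\sum_i H i i)
    + 2 * l * (\sum_i \sum_j g i * g j * H i j) + 2 * l * (\sum_i g i ^+ 2)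
  <= \sum_i \sum_j H i j ^+ 2.
Proof.
set G := \sum_i g i ^+ 2; set tau := \sum_i H i i.
set P := \sum_i \sum_j g i * g j * H i j.
rewrite -subr_ge0.
suff -> : \sum_i \sum_j H i j ^+ 2 - (- d%:R - l ^+ 2 * G ^+ 2 - 2 * tau
    + 2 * l * P + 2 * l * G) =
    \sum_i \sum_j (H i j + (i == j)%:R - l * (g i * g j)) ^+ 2.
  by apply: sumr_ge0 => i _; apply: sumr_ge0 => j _; exact: sqr_ge0.
have E i : \sum_j (H i j + (i == j)%:R - l * (g i * g j)) ^+ 2 =
    \sum_j H i j ^+ 2 + 1 + l ^+ 2 * G * g i ^+ 2 + 2 * H i i
    - 2 * l * \sum_j g i * g j * H i j - 2 * l * g i ^+ 2.
  have -> : \sum_j (H i j + (i == j)%:R - l * (g i * g j)) ^+ 2 =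
    \sum_j (H i j ^+ 2 + (j == i)%:R * (1 + 2 * H i j - 2 * l * (g i * g j))
     + l ^+ 2 * g i ^+ 2 * (g j ^+ 2) - 2 * l * (g i * g j * H i j)).
    apply: eq_bigr => j _; rewrite eq_sym; case: eqP => _ /=; by ring.
  rewrite sumrB !big_split /= sum_delta -!mulr_sumr -/G; ring.
under [RHS]eq_bigr do rewrite E.
rewrite !sumrB !big_split /= -!mulr_sumr sumr_const card_ord -/G -/tau -/P.
by ring.
Qed.

End contraction.

(** * The pointwise inequality at a maximum *)

(** In units where c = 1, the variables stand for p = g.Hg, Q = |Hg|^2,
    h2 = |H|^2, tau = tr H, q = g.grad b, r = grad b.Hg, B = |grad b|^2, and
    [ch] for the contraction of the Hessian of b.  The equations for p, r and Q
    express that N + b is critical, the one for [tau] is the flow equation, and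
    the inequality that ends in [ch <= 0] is the second-order condition at a
    maximum.  With h2 replaced by its lower bound for l = 2 / mu, the left side
    of the latter without [ch] collapses to 2 (d - N) + X / mu, where X is
    nonnegative up to an error of order delta. *)
Lemma scalar_contradiction (R : realType)
    (d m N p Q h2 tau q r B ch delta mu0 : R) :
  2 <= d -> 0 <= N <= 1 -> 0 < mu0 -> mu0 <= 2 -> mu0 <= 2 - N * m ->
  0 < delta -> delta * (4 * (5 + 9 * `|m|)) <= mu0 ->
  (2 - N * m) * p = N ^+ 2 * m - q ->
  (2 - N * m) * r = N * m * q - B ->
  (2 - N * m) * Q = N * m * p - r ->
  tau - p = N - d ->
  (forall l, - d - l ^+ 2 * N ^+ 2 - 2 * tau + 2 * l * p + 2 * l * N <= h2) ->
  (2 - N * m) * (2 * p - (d + tau) * m * (N + p) + Q + h2) - N * m * (N - d)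
    + 2 * m * (q + r) - 2 * m * q * (N + p) + ch <= 0 ->
  - (d * delta) <= ch -> `|q| <= delta -> 0 <= B <= delta ^+ 2 -> False.
Proof.
move=> d2 /andP[N0 N1] mu00 mu02 muN del0 delm ep er eQ et eh e7 hch hq /andP[B0 B1].
set mu := 2 - N * m in muN ep er eQ e7.
have mup : 0 < mu by lra.
have mune : mu != 0 by lra.
have m0 : 0 <= `|m| by [].
have [mm Mm] : m <= `|m| /\ - `|m| <= m.
  by split; [exact: ler_norm | rewrite lerNl -normrN ler_norm].
have del1 : delta <= 1 / 10 by nra.
have [q1 q2] : q <= delta /\ - delta <= q by move: hq; rewrite ler_norml => /andP[].
pose X := 4 * N * (1 - N) - 2 * q * (2 + N * m - 2 * m) + m * q ^+ 2
   + (1 - 2 * m) * B.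
have HX : - (mu / 4) <= X.
  have b1 : 0 <= 4 * N * (1 - N) by nra.
  have b2 : - (delta * (4 + 4 * `|m|)) <= - 2 * q * (2 + N * m - 2 * m).
    have w : `|2 + N * m - 2 * m| <= 2 + 2 * `|m|.
      rewrite ler_norml; apply/andP; split; nra.
    have : `|- 2 * q * (2 + N * m - 2 * m)| <= 2 * delta * (2 + 2 * `|m|).
      by rewrite !normrM normrN (ger0_norm (x := 2)) // ler_pM // ?mulr_ge0 //; lra.
    by rewrite ler_norml => /andP[+ _]; lra.
  have qq : q ^+ 2 <= delta by nra.
  have q0 : 0 <= q ^+ 2 by exact: sqr_ge0.
  have b3 : - (`|m| * delta) <= m * q ^+ 2 by nra.
  have Bd : B <= delta by nra.
  have b4 : - (2 * `|m| * delta) <= (1 - 2 * m) * B by nra.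
  rewrite /X; nra.
have pE : p = (N ^+ 2 * m - q) / mu by rewrite -ep mulrC mulKf.
have rE : r = (N * m * q - B) / mu by rewrite -er mulrC mulKf.
have QE : Q = (N * m * p - r) / mu by rewrite -eQ mulrC mulKf.
have tE : tau = N - d + p by lra.
have {}eh := eh (2 / mu).
set low := (X in X <= h2) in eh.
have E : mu * (2 * p - (d + tau) * m * (N + p) + Q + low) - N * m * (N - d)
    + 2 * m * (q + r) - 2 * m * q * (N + p) = 2 * (d - N) + X / mu.
  rewrite /low tE QE rE pE /X /mu; field.
  by rewrite -/mu.
have h : mu * low <= mu * h2 by rewrite ler_pM2l.
have Xm : - (1 / 4) <= X / mu by rewrite ler_pdivlMr //; lra.
have : 2 * (d - N) + X / mu + ch <= 0 by rewrite -E; lra.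
nra.
Qed.

Section jet.
Context (R : realType) (d : nat) (m s : R) (g : 'I_d -> R)
  (H : 'I_d -> 'I_d -> R) (T : 'I_d -> 'I_d -> 'I_d -> R).

(** In this section [g], [H], [T] are the first, second and third derivatives of
    the potential at one point and [s] is the square of the sound speed.  The
    functions [jet_*] are the derived quantities as algebraic expressions in
    these numbers; H g is half the gradient of |g|^2. *)
Definition jet_Hg i := \sum_k H i k * g k.

Definition jet_mach2 := (\sum_i g i ^+ 2) / s.

(** The gradient of the square of the sound speed; for gamma = 1 it is 0, in
    accordance with m = 0. *)
Definition jet_ds i := m * (g i + jet_Hg i).

(** The derivative in the direction [i] of the component [j] of H g. *)
Definition jet_dHg i j := \sum_k (T i j k * g k + H j k * H i k).

(** Derivatives of the quotient |g|^2 / s.  The quotient rule is kept in the form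
    (u' - (u / v) v') / v, so that N and its derivatives reappear on the right;
    at a critical point they can be replaced by those of - b. *)
Definition jet_dmach2 i := (2 * jet_Hg i - jet_mach2 * jet_ds i) / s.

Definition jet_ddmach2 i j :=
  (2 * jet_dHg i j
   - (jet_dmach2 i * jet_ds j + jet_mach2 * (m * (H i j + jet_dHg i j)))
   - jet_dmach2 j * jet_ds i) / s.

Local Notation V := jet_Hg.
Local Notation N := jet_mach2.

(** The differentiated flow equation eliminates the third derivatives from the
    contraction of [jet_ddmach2].  What is left depends only on the scalar
    products listed at [scalar_contradiction]. *)
Lemma jet_contradiction (chat delta mu0 : R) (db : 'I_d -> R)
    (ddb : 'I_d -> 'I_d -> R) :
  (2 <= d)%N -> 0 < s -> 0 < chat -> s <= chat ^+ 2 ->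
  0 < mu0 -> mu0 <= 2 -> mu0 <= 2 - m ->
  0 < delta -> delta * (4 * (5 + 9 * `|m|)) <= mu0 ->
  \sum_i g i ^+ 2 <= s ->
  (forall i j, H i j = H j i) -> (forall i j k, T i j k = T k i j) ->
  s * (\sum_i H i i) - \sum_i \sum_j g i * g j * H i j
    = \sum_i g i ^+ 2 - d%:R * s ->
  (forall k, jet_ds k * (\sum_i H i i) + s * (\sum_i T k i i)
    - \sum_i \sum_j ((H k i * g j + g i * H k j) * H i j + g i * g j * T k i j)
    = 2 * V k - d%:R * jet_ds k) ->
  (forall i, jet_dmach2 i + db i = 0) ->
  contract s g (fun i j => jet_ddmach2 i j + ddb i j) <= 0 ->
  \sum_i db i ^+ 2 <= (delta / chat) ^+ 2 ->
  \sum_i \sum_j ddb i j ^+ 2 <= (delta / chat ^+ 2) ^+ 2 -> False.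
Proof.
move=> d2 s0 ch0 sch mu00 mu02 mum del0 delm Gs Hsym Tsym pde dpde crit nsd hdb hddb.
set G := \sum_i g i ^+ 2 in Gs pde; set tau := \sum_i H i i in pde dpde.
set P := \sum_i \sum_j _ in pde.
have sne : s != 0 by rewrite gt_eqF.
have G0 : 0 <= G by apply: sumr_ge0 => i _; exact: sqr_ge0.
have N01 : 0 <= N <= 1.
  by rewrite /jet_mach2 -/G divr_ge0 ?(ltW s0) //= ler_pdivrMr // mul1r.
have GN : G = s * N by rewrite /jet_mach2 -/G mulrC divfK.
have mumu : mu0 <= 2 - N * m by nra.
have crit' i : (2 - N * m) * V i = N * m * g i - s * db i.
  have := crit i; rewrite /jet_dmach2 /jet_ds => /(congr1 ( *%R s)).
  by rewrite mulr0 mulrDr mulrC divfK // => h; lra.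
(* The vector equation mu Hg = m N g - s grad b is used only through its scalar
   products with g, grad b and Hg. *)
have critw (w : 'I_d -> R) : (2 - N * m) * (\sum_i w i * V i) =
    N * m * (\sum_i w i * g i) - s * (\sum_i w i * db i).
  rewrite !mulr_sumr -sumrB; apply: eq_bigr => i _.
  by rewrite mulrCA crit'; ring.
pose q := \sum_i g i * db i; pose r := \sum_i db i * V i.
pose Q := \sum_i V i * V i; pose Bn := \sum_i db i * db i.
have PE : P = \sum_i g i * V i.
  apply: eq_bigr => i _; rewrite mulr_sumr; apply: eq_bigr => j _; ring.
have GE : \sum_i g i * g i = G by apply: eq_bigr => i _; rewrite expr2.
have e1 := critw g; rewrite -PE GE -/q in e1.
have e2 := critw db; rewrite -/r -/Bn in e2.
have e3 := critw V; rewrite -/Q in e3.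
have qE : \sum_i db i * g i = q by apply: eq_bigr => i _; rewrite mulrC.
have rE : \sum_i V i * db i = r by apply: eq_bigr => i _; rewrite mulrC.
have PE' : \sum_i V i * g i = P by rewrite PE; apply: eq_bigr => i _; rewrite mulrC.
rewrite qE in e2; rewrite rE PE' in e3.
pose h2 := \sum_i \sum_j H i j ^+ 2.
have VE k : \sum_i g i * H i k = V k.
  by apply: eq_bigr => i _; rewrite Hsym mulrC.
have cT k : contract s g (T k) =
    2 * V k - d%:R * jet_ds k - jet_ds k * tau + 2 * \sum_i H k i * V i.
  have E : \sum_i \sum_j ((H k i * g j + g i * H k j) * H i j + g i * g j * T k i j)
      = 2 * \sum_i H k i * V i + \sum_i \sum_j g i * g j * T k i j.
    have -> : 2 * \sum_i H k i * V i = \sum_i H k i * V i + \sum_i \sum_j g i * H k j * H i j.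
      rewrite mulr_natl mulr2n; congr (_ + _).
      rewrite exchange_big; apply: eq_bigr => j _; rewrite -VE mulr_sumr.
      by apply: eq_bigr => i _; ring.
    rewrite -!big_split; apply: eq_bigr => i _ /=.
    rewrite mulr_sumr -!big_split; apply: eq_bigr => j _ /=; ring.
  have := dpde k; rewrite E /contract; lra.
have cK : contract s g (fun i j => \sum_k T i j k * g k) =
    2 * P - (d%:R + tau) * (m * (G + P)) + 2 * Q.
  rewrite contract_sum.
  have -> : \sum_k contract s g (fun i j => T i j k * g k) =
    \sum_k (2 * (g k * V k) - (d%:R + tau) * (m * (g k * g k + g k * V k))
       + 2 * \sum_i g k * H k i * V i).
    apply: eq_bigr => k _.
    rewrite (@eq_contract _ _ _ _ _ (fun i j => g k * T k i j)); last first.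
      by move=> i j; rewrite mulrC Tsym.
    rewrite contractZ cT /jet_ds.
    under [X in _ = _ + 2 * X]eq_bigr do rewrite -mulrA.
    by rewrite -mulr_sumr; ring.
  rewrite big_split sumrB /= -!mulr_sumr big_split /= GE -PE; congr (_ + 2 * _).
  rewrite exchange_big; apply: eq_bigr => i _ /=; rewrite -mulr_suml VE.
  by [].
have cHH : contract s g (fun i j => \sum_k H j k * H i k) = s * h2 - Q.
  rewrite contract_sum.
  have -> : \sum_k contract s g (fun i j => H j k * H i k) =
      \sum_k (s * (\sum_i H i k ^+ 2) - V k * V k).
    apply: eq_bigr => k _.
    rewrite (@eq_contract _ _ _ _ _ (fun i j => H i k * H j k)); last first.
      by move=> i j; rewrite mulrC.
    by rewrite contract_rank1 VE.
  by rewrite sumrB -mulr_sumr exchange_big.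
have cV : contract s g jet_dHg = 2 * P - (d%:R + tau) * (m * (G + P)) + Q + s * h2.
  rewrite (@eq_contract _ _ _ _ _
    (fun i j => \sum_k T i j k * g k + \sum_k H j k * H i k)).
    by rewrite contractD cK cHH; ring.
  by move=> i j; rewrite /jet_dHg big_split.
have dbS : \sum_i db i * jet_ds i = m * (q + r).
  by rewrite -qE -big_split mulr_sumr; apply: eq_bigr => i _ /=; rewrite /jet_ds; ring.
have gS : \sum_i g i * jet_ds i = m * (G + P).
  by rewrite PE -GE -big_split mulr_sumr; apply: eq_bigr => i _ /=; rewrite /jet_ds; ring.
have Sdb : \sum_i jet_ds i * db i = m * (q + r).
  by rewrite -dbS; apply: eq_bigr => i _; rewrite mulrC.
have dme i : jet_dmach2 i = - db i by apply/eqP; rewrite -addr_eq0 crit.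
(* At the critical point the gradient of N is - grad b. *)
have Z : contract s g (fun i j => jet_ddmach2 i j + ddb i j) =
    s^-1 * ((2 - N * m) * (2 * P - (d%:R + tau) * (m * (G + P)) + Q + s * h2)
      - N * m * (G - d%:R * s)
      + 2 * (s * (m * (q + r)) - q * (m * (G + P)))) + contract s g ddb.
  rewrite contractD; congr (_ + _).
  rewrite (@eq_contract _ _ _ _ _ (fun i j => s^-1 * (((2 - N * m) * jet_dHg i j +
    (- (N * m)) * H i j) + (db i * jet_ds j + jet_ds i * db j)))); last first.
    by move=> i j; rewrite /jet_ddmach2 !dme; ring.
  rewrite contractZ 2!contractD !contractZ contractD !contract_rank1.
  rewrite dbS Sdb gS -/q cV [X in - _ * X]/contract pde; congr (_ * _); ring.
have ss : s / chat ^+ 2 <= 1 by rewrite ler_pdivrMr ?exprn_gt0 // mul1r.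
have ss0 : 0 <= s / chat ^+ 2 by rewrite divr_ge0 // ?exprn_ge0 // ltW.
have hB : 0 <= s * Bn <= delta ^+ 2.
  have BE : Bn = \sum_i db i ^+ 2 by [].
  apply/andP; split.
    by rewrite mulr_ge0 ?(ltW s0) // BE sumr_ge0 // => i _; exact: sqr_ge0.
  apply: (le_trans (ler_wpM2l (ltW s0) hdb)).
  rewrite (_ : s * _ = s / chat ^+ 2 * delta ^+ 2); last by field; lra.
  by rewrite ler_piMl ?sqr_ge0.
have hq : `|q| <= delta.
  (* The weight delta / s balances |g|^2 <= s against |grad b|^2 <= delta^2 / s. *)
  have ds0 : 0 < delta / s by rewrite divr_gt0.
  apply: (le_trans (sum_mul_le g db ds0)); rewrite -/G ler_pdivrMr // mulr_natr mulr2n.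
  apply: lerD.
    by rewrite mulrAC ler_pdivrMr // ler_pM2l.
  rewrite invf_div mulrAC ler_pdivrMr // -expr2.
  by have /andP[] := hB.
have hch : - (d%:R * delta) <= contract s g ddb.
  (* The weight balances s^2 d against |Hess b|^2 <= delta^2 / s^2. *)
  have ds0 : 0 < delta / s ^+ 2 by rewrite divr_gt0 // exprn_gt0.
  apply: le_trans _ (contract_ge s0 Gs ds0 hddb).
  rewrite lerN2 invf_div.
  rewrite (_ : delta / s ^+ 2 * (s ^+ 2 * d%:R) = delta * d%:R); last by field.
  rewrite (_ : s ^+ 2 / delta * _ = (s / chat ^+ 2) ^+ 2 * delta); last by field; lra.
  have : (s / chat ^+ 2) ^+ 2 <= 1 by rewrite expr_le1.
  have : 1 <= d%:R :> R by rewrite ler1n ltnW.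
  nra.
have D2 : 2 <= d%:R :> R by rewrite ler_nat.
apply: (@scalar_contradiction R d%:R m N (P / s) (Q / s) h2 tau q r (s * Bn)
  (contract s g ddb) delta mu0) => //.
- by rewrite mulrA e1 GN; field.
- by rewrite [(2 - _) * (Q / s)]mulrA e3; field.
- by apply: (mulfI sne); rewrite mulrBr [s * (P / s)]mulrC divfK // pde GN; ring.
- move=> l; have := sum_sqr_hessian_ge g H (l / s); rewrite -/G -/tau -/P -/h2.
  apply: le_trans; rewrite GN le_eqVlt; apply/orP; left; apply/eqP; field.
  by [].
- move: nsd; rewrite Z GN => nsd; apply: le_trans nsd.
  rewrite lerD2r le_eqVlt; apply/orP; left; apply/eqP; field.
  by [].
Qed.

End jet.

(** * Calculus of functions with continuous partial derivatives *)

Section has_partials_algebra.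
Context (R : realType) (d : nat) (Om W : set 'rV[R]_d).
Implicit Types (f g : 'rV[R]_d -> R) (df dg : 'I_d -> 'rV[R]_d -> R).

Lemma eq_has_partials f f' df df' :
  (forall x, f x = f' x) -> (forall i x, df i x = df' i x) ->
  has_partials Om W f df -> has_partials Om W f' df'.
Proof.
move=> /funext -> E; have -> : df = df' by apply/funext => i; apply/funext => x.
by [].
Qed.

Lemma has_partials_cst (a : R) :
  has_partials Om W (fun=> a) (fun _ _ => 0).
Proof.
by split=> [x _|i x _|i x _]; [exact: cvg_cst | exact: cvg_cst | exact: is_derive_cst].
Qed.

Lemma has_partialsD f df g dg :
  has_partials Om W f df -> has_partials Om W g dg ->
  has_partials Om W (fun x => f x + g x) (fun i x => df i x + dg i x).
Proof.
move=> [cf cdf Df] [cg cdg Dg]; split=> [x Wx|i x Wx|i x Ox].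
- by apply: cvgD; [exact: cf | exact: cg].
- by apply: cvgD; [exact: cdf | exact: cdg].
- by apply: is_deriveD; [exact: Df | exact: Dg].
Qed.

Lemma has_partialsM f df g dg :
  has_partials Om W f df -> has_partials Om W g dg ->
  has_partials Om W (fun x => f x * g x)
    (fun i x => df i x * g x + f x * dg i x).
Proof.
move=> [cf cdf Df] [cg cdg Dg]; split=> [x Wx|i x Wx|i x Ox].
- by apply: cvgM; [exact: cf | exact: cg].
- by apply: cvgD; apply: cvgM; by [exact: cf | exact: cg | exact: cdf | exact: cdg].
- apply: (is_derive_eq (is_deriveM (Df i x Ox) (Dg i x Ox))).
  by rewrite /GRing.scale /= addrC mulrC.
Qed.

Lemma has_partialsZ a f df : has_partials Om W f df ->
  has_partials Om W (fun x => a * f x) (fun i x => a * df i x).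
Proof.
move=> hf; apply: eq_has_partials (has_partialsM (has_partials_cst a) hf) => //.
by move=> i x; rewrite mul0r add0r.
Qed.

Lemma has_partialsB f df g dg :
  has_partials Om W f df -> has_partials Om W g dg ->
  has_partials Om W (fun x => f x - g x) (fun i x => df i x - dg i x).
Proof.
move=> hf hg.
apply: eq_has_partials (has_partialsD hf (has_partialsZ (-1) hg)) => [x|i x];
  by rewrite mulN1r.
Qed.

Lemma has_partials_sum n (f : 'I_n -> 'rV[R]_d -> R)
    (df : 'I_n -> 'I_d -> 'rV[R]_d -> R) :
  (forall k, has_partials Om W (f k) (df k)) ->
  has_partials Om W (fun x => \sum_k f k x) (fun i x => \sum_k df k i x).
Proof.
move=> hf; split=> [x Wx|i x Wx|i x Ox].
- by apply: cvg_sum_in => k; have [+ _ _] := hf k; apply.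
- by apply: cvg_sum_in => k; have [_ + _] := hf k; apply.
- rewrite (_ : (fun x => _) = \sum_k f k); last by rewrite fct_sumE.
  by apply: is_derive_sum => k; have [_ _] := hf k; apply.
Qed.

Lemma has_partialsV f df : Om `<=` W -> (forall x, W x -> f x != 0) ->
  has_partials Om W f df ->
  has_partials Om W (fun x => (f x)^-1) (fun i x => - (f x)^-1 ^+ 2 * df i x).
Proof.
move=> OW f0 [cf cdf Df]; split=> [x Wx|i x Wx|i x Ox].
- by apply: cvgV; [exact: f0 | exact: cf].
- apply: cvgM; last exact: cdf.
  apply: cvgN; rewrite expr2; under eq_fun do rewrite expr2.
  by apply: cvgM; (apply: cvgV; [exact: f0 | exact: cf]).
- have fx := f0 x (OW x Ox); have [Dx <-] := Df i x Ox; split.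
    exact: derivableV.
  by rewrite deriveV // /GRing.scale /= exprVn.
Qed.

End has_partials_algebra.

Section closure_of_identities.
Context (R : realType) (d : nat) (i0 : 'I_d) (Om Ga : set 'rV[R]_d).
Hypothesis hs : half_space_like i0 Om Ga.
Local Notation W := (Om `|` Ga).

(** An identity that holds in the open set may be differentiated there, and both
    the identity and its derivatives extend to the boundary by continuity. *)
Lemma has_partials_eq0 F dF : has_partials Om W F dF ->
  (forall x, Om x -> F x = 0) ->
  forall x, W x -> F x = 0 /\ forall i, dF i x = 0.
Proof.
move=> [cF cdF DF] F0 x Wx; split; first by apply: (eq0_closure hs Wx (cF x Wx)).
move=> i; apply: (eq0_closure hs Wx (cdF i x Wx)) => y Oy.
have [_ <-] := DF i y Oy.
have [Oo _] := hs.
rewrite (near_eq_derive (g := cst 0)) ?derive_cst //.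
by apply: filterS (open_nbhs_nbhs (conj Oo Oy)) => z; exact: F0.
Qed.

Lemma Ck_within k f x : Ck Om Ga k f -> W x ->
  f y @[y --> within W (nbhs x)] --> f x.
Proof. by case: k => [|k] [/subspace_continuousP + _] Wx; apply. Qed.

Lemma Ck_has_partials k f : Ck Om Ga k.+1 f ->
  has_partials Om W f (fun i => pd Om i f) /\
  forall i, Ck Om Ga k (pd Om i f).
Proof.
move=> Hf; have [_ /= H] := Hf.
split; last by move=> i; have [] := H i.
split=> [x Wx|i x Wx|i x Ox].
- exact: Ck_within Hf Wx.
- by have [_ /Ck_within] := H i; apply.
- have [/(_ x Ox) Df _] := H i.
  by rewrite /pd mem_set //; exact: derivableP.
Qed.

End closure_of_identities.

Lemma frob_row_sqr (R : realType) (d : nat) (v : 'rV[R]_d) :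
  frob v ^+ 2 = \sum_i v 0 i ^+ 2.
Proof.
rewrite /frob big_ord1 sqr_sqrtr // sumr_ge0 // => i _; exact: sqr_ge0.
Qed.

Lemma frob_ge0 (R : realType) (m n : nat) (A : 'M[R]_(m, n)) : 0 <= frob A.
Proof. exact: sqrtr_ge0. Qed.

Lemma eball_open (R : realType) (d : nat) (a : 'rV[R]_d) (r : R) :
  open (eball a r).
Proof.
have cf : continuous (fun x : 'rV[R]_d => frob (x - a)).
  move=> x; apply: (@continuous_comp _ _ _ _ (@Num.sqrt R)).
    apply: (@cvg_sum_in _ _ (nbhs x)) => i.
    apply: (@cvg_sum_in _ _ (nbhs x)) => j; rewrite expr2.
    under eq_fun do rewrite expr2.
    have c : (y - a) i j @[y --> nbhs x] --> (x - a) i j.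
      have -> : (fun y : 'rV[R]_d => (y - a) i j) = (fun y => y i j - a i j).
        by apply/funext => y; rewrite !mxE.
      rewrite !mxE; apply: (@cvgB _ _ _ (nbhs x)); last exact: cvg_cst.
      exact: (@coord_continuous R 1 d i j x).
    by apply: cvgM.
  exact: sqrt_continuous.
exact: (open_comp (fun x _ => cf x) (@open_lt R r)).
Qed.

Lemma half_ball_like (R : realType) (d : nat) (i0 : 'I_d) (a : 'rV[R]_d) (r : R) :
  half_space_like i0 (half_dom i0 (eball a r)) (flat_bdry i0 (eball a r)).
Proof.
split.
  apply: openI; first exact: eball_open.
  apply: (open_comp _ (@open_gt R 0)) => x _; exact: coord_continuous.
move=> x [Ux x0]; split=> //.
have := open_nbhs_nbhs (conj (@eball_open R d a r) Ux).
by apply: filterS => y Uy; split=> ?; split.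
Qed.

(** * The squared pseudo-Mach number of a flow *)

(** The square of the sound speed is a polynomial expression in the potential and
    its gradient, hence differentiable without further conditions. *)
Definition sound_speed2 (R : realType) (d : nat) (Om : set 'rV[R]_d)
    (gamma c0 : R) (chi : 'rV[R]_d -> R) (x : 'rV[R]_d) : R :=
  if gamma == 1 then c0 ^+ 2
  else (1 - gamma) * (chi x + 2^-1 * \sum_k pd Om k chi x ^+ 2).

(** If gamma is not 1, the relation between density and potential says that c^2 is
    c0^2 (rho / rho0)^(gamma - 1). *)
Lemma sound_speed2_gt0 (R : realType) (d : nat) (Om : set 'rV[R]_d)
    (gamma c0 rho0 : R) (chi : 'rV[R]_d -> R) (x : 'rV[R]_d) :
  0 < c0 -> 0 < rho0 -> positive_density Om gamma c0 rho0 chi x ->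
  0 < sound_speed2 Om gamma c0 chi x.
Proof.
move=> c00 rho00 [rho rho_gt0]; rewrite /pi_fun /sound_speed2 frob_row_sqr.
case: eqP => [_ _|/eqP g1 E]; first by rewrite exprn_gt0.
have -> : \sum_k pd Om k chi x ^+ 2 = \sum_k grad Om chi x 0 k ^+ 2.
  by apply: eq_bigr => k _; rewrite mxE.
have -> : (1 - gamma) * (chi x + 2^-1 * \sum_k grad Om chi x 0 k ^+ 2) =
    c0 ^+ 2 * (rho / rho0) `^ (gamma - 1).
  transitivity ((gamma - 1) * (- chi x - 2^-1 * \sum_k grad Om chi x 0 k ^+ 2)).
    by ring.
  by rewrite -E; field; rewrite subr_eq0.
by rewrite mulr_gt0 ?exprn_gt0 // powR_gt0 // divr_gt0.
Qed.

Lemma sound_speedE (R : realType) (d : nat) (Om : set 'rV[R]_d)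
    (gamma c0 : R) (chi : 'rV[R]_d -> R) (x : 'rV[R]_d) :
  0 < c0 -> sound_speed Om gamma c0 chi x = Num.sqrt (sound_speed2 Om gamma c0 chi x).
Proof.
move=> c00; rewrite /sound_speed /sound_speed2; case: eqP => _.
  by rewrite sqrtr_sqr gtr0_norm.
rewrite frob_row_sqr; congr (Num.sqrt (_ * (_ + _ * _))).
by apply: eq_bigr => k _; rewrite mxE.
Qed.

Lemma quotient_ruleE (R : realType) (u du v dv : R) :
  du * v^-1 + u * (- v^-1 ^+ 2 * dv) = (du - u / v * dv) / v.
Proof. ring. Qed.

Section flow.
Context (R : realType) (d : nat) (i0 : 'I_d) (Om Ga : set 'rV[R]_d).
Hypothesis hs : half_space_like i0 Om Ga.
Local Notation W := (Om `|` Ga).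
Context (gamma c0 rho0 : R) (chi : 'rV[R]_d -> R).
Hypothesis c0_gt0 : 0 < c0.
Hypothesis rho0_gt0 : 0 < rho0.
Hypothesis chiC3 : Ck Om Ga 3 chi.
Hypothesis density : forall x, W x -> positive_density Om gamma c0 rho0 chi x.
Hypothesis flow : forall x, Om x -> potential_flow Om gamma c0 chi x.
Hypothesis slip : forall x, Ga x -> pd Om i0 chi x = 0.

Let m := 1 - gamma.
Let s := sound_speed2 Om gamma c0 chi.
Let g i := pd Om i chi.
Let H i j := pd Om i (g j).
Let T i j k := pd Om i (H j k).

Lemma chi_partials : has_partials Om W chi g.
Proof. by have [] := Ck_has_partials chiC3. Qed.

Lemma g_partials j : has_partials Om W (g j) (H^~ j).
Proof.
by have [_ /(_ j) /Ck_has_partials[]] := Ck_has_partials chiC3.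
Qed.

Lemma H_partials j k : has_partials Om W (H j k) (fun i => T i j k).
Proof.
by have [_ /(_ k) /Ck_has_partials[_ /(_ j) /Ck_has_partials[]]] :=
  Ck_has_partials chiC3.
Qed.

Lemma s_gt0 x : W x -> 0 < s x.
Proof. by move=> Wx; exact: sound_speed2_gt0 (density Wx). Qed.

Lemma H_sym x i j : W x -> H i j x = H j i x.
Proof.
move=> Wx; exact: (@partials_sym _ _ _ _ _ hs chi g H _ _ _
  chi_partials g_partials Wx).
Qed.

(** The derivative [T i j k] differentiates first in the direction [k] and last in
    [i].  Symmetry of H, differentiated, exchanges [j] and [k]; symmetry of the
    second derivatives of chi_j then exchanges the two outer ones. *)
Lemma T_sym x i j k : W x -> T i j k x = T k i j x.
Proof.
move=> Wx; transitivity (T i k j x); last first.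
  exact: (@partials_sym _ _ _ _ _ hs (g j) (H^~ j) (fun i k => T i k j) _ _ _
    (g_partials j) (H_partials^~ j) Wx).
apply/eqP; rewrite -subr_eq0; apply/eqP.
have [|_] := has_partials_eq0 hs
  (has_partialsB (H_partials j k) (H_partials k j)) _ Wx.
  by move=> y Oy; rewrite H_sym ?subrr //; left.
exact.
Qed.

Lemma G_partials : has_partials Om W (fun x => \sum_k g k x ^+ 2)
  (fun i x => 2 * jet_Hg (fun i => g i x) (fun i j => H i j x) i).
Proof.
apply: eq_has_partials
  (has_partials_sum (fun k => has_partialsM (g_partials k) (g_partials k))).
  by move=> x; apply: eq_bigr => k _; rewrite expr2.
move=> i x; rewrite /jet_Hg mulr_sumr; apply: eq_bigr => k _; ring.
Qed.

Lemma s_partials : has_partials Om W s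
  (fun i x => jet_ds m (fun i => g i x) (fun i j => H i j x) i).
Proof.
rewrite /s /sound_speed2 /jet_ds /m; case: eqP => [->|_].
  apply: eq_has_partials (has_partials_cst _ _ (c0 ^+ 2)) => // i x.
  by rewrite subrr mul0r.
apply: eq_has_partials (has_partialsZ (1 - gamma)
  (has_partialsD chi_partials (has_partialsZ 2^-1 G_partials))) => // i x.
by rewrite mulrA mulVf // mul1r.
Qed.

Lemma Hg_partials j : has_partials Om W
  (fun x => jet_Hg (fun i => g i x) (fun i j => H i j x) j)
  (fun i x => jet_dHg (fun i => g i x) (fun i j => H i j x)
     (fun i j k => T i j k x) i j).
Proof.
exact: (has_partials_sum (fun k => has_partialsM (H_partials j k) (g_partials k))).
Qed.

Lemma ds_partials j : has_partials Om W
  (fun x => jet_ds m (fun i => g i x) (fun i j => H i j x) j)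
  (fun i x => m * (H i j x + jet_dHg (fun i => g i x) (fun i j => H i j x)
     (fun i j k => T i j k x) i j)).
Proof.
exact: (eq_has_partials _ _
  (has_partialsZ m (has_partialsD (g_partials j) (Hg_partials j)))).
Qed.

Lemma sV_partials : has_partials Om W (fun x => (s x)^-1)
  (fun i x => - (s x)^-1 ^+ 2 * jet_ds m (fun i => g i x) (fun i j => H i j x) i).
Proof.
apply: has_partialsV s_partials; first by move=> x; left.
by move=> x Wx; rewrite gt_eqF // s_gt0.
Qed.

Lemma mach2_partials : has_partials Om W
  (fun x => jet_mach2 (s x) (fun i => g i x))
  (fun i x => jet_dmach2 m (s x) (fun i => g i x) (fun i j => H i j x) i).
Proof.
apply: eq_has_partials (has_partialsM G_partials sV_partials) => // i x.
by rewrite /jet_dmach2 /jet_mach2; exact: quotient_ruleE.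
Qed.

Lemma dmach2_partials j : has_partials Om W
  (fun x => jet_dmach2 m (s x) (fun i => g i x) (fun i j => H i j x) j)
  (fun i x => jet_ddmach2 m (s x) (fun i => g i x) (fun i j => H i j x)
     (fun i j k => T i j k x) i j).
Proof.
have h := has_partialsM (has_partialsB (has_partialsZ 2 (Hg_partials j))
  (has_partialsM mach2_partials (ds_partials j))) sV_partials.
apply: eq_has_partials h => // i x.
exact: quotient_ruleE.
Qed.

(** The flow equation and its derivative in the direction [k], also on the
    boundary. *)
Lemma flow_jet x : W x ->
  s x * (\sum_i H i i x) - \sum_i \sum_j g i x * g j x * H i j x
    = \sum_i g i x ^+ 2 - d%:R * s x /\
  forall k, jet_ds m (fun i => g i x) (fun i j => H i j x) k * (\sum_i H i i x)
    + s x * (\sum_i T k i i x)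
    - \sum_i \sum_j ((H k i x * g j x + g i x * H k j x) * H i j x
      + g i x * g j x * T k i j x)
    = 2 * jet_Hg (fun i => g i x) (fun i j => H i j x) k
      - d%:R * jet_ds m (fun i => g i x) (fun i j => H i j x) k.
Proof.
move=> Wx.
have h := has_partialsB (has_partialsB
  (has_partialsM s_partials (has_partials_sum (fun i => H_partials i i)))
  (has_partials_sum (fun i => has_partials_sum (fun j =>
     has_partialsM (has_partialsM (g_partials i) (g_partials j)) (H_partials i j)))))
  (has_partialsB G_partials (has_partialsZ d%:R s_partials)).
have [|E dE] := has_partials_eq0 hs h _ Wx.
  move=> y Oy; have := flow Oy; rewrite /potential_flow /laplacian /mxtrace /=.
  have sy : 0 < s y by apply: s_gt0; left.
  rewrite sound_speedE // sqr_sqrtr ?(ltW sy) // frob_row_sqr.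
  under eq_bigr do rewrite mxE.
  under [X in _ - X]eq_bigr do under eq_bigr do rewrite !mxE.
  under [X in _ = X - _]eq_bigr do rewrite mxE.
  by move=> ->; rewrite subrr.
split; first by apply/eqP; rewrite -subr_eq0; apply/eqP.
by move=> k; apply/eqP; rewrite -subr_eq0; apply/eqP; exact: dE.
Qed.

(** On the flat boundary g is tangential by the slip condition, and so is H g,
    because there the mixed derivatives of chi in one normal and one tangential
    direction vanish. *)
Lemma dmach2_neumann x : Ga x ->
  jet_dmach2 m (s x) (fun i => g i x) (fun i j => H i j x) i0 = 0.
Proof.
move=> Gx; have Wx : W x by right.
have V0 : jet_Hg (fun i => g i x) (fun i j => H i j x) i0 = 0.
  apply: big1 => k _; have [->|ki] := eqVneq k i0.
    by rewrite [g i0 x]slip // mulr0.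
  by rewrite H_sym // (tangential_partial0 hs (g_partials i0) slip) ?mul0r.
by rewrite /jet_dmach2 /jet_ds V0 [g i0 x]slip // addr0 !mulr0 subr0 mul0r.
Qed.

Lemma mach2E x : W x ->
  mach Om gamma c0 chi x ^+ 2 = jet_mach2 (s x) (fun i => g i x).
Proof.
move=> Wx; rewrite /mach expr_div_n frob_row_sqr sound_speedE //.
rewrite sqr_sqrtr ?(ltW (s_gt0 Wx)) // /jet_mach2.
by under eq_bigr do rewrite mxE.
Qed.

Lemma mach2_perturbed_no_max (b : 'rV[R]_d -> R) (chat delta mu0 : R) :
  (2 <= d)%N -> 0 < chat -> 0 < mu0 -> mu0 <= 2 -> mu0 <= 2 - m ->
  0 < delta -> delta * (4 * (5 + 9 * `|m|)) <= mu0 ->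
  Ck Om Ga 2 b -> (forall x, Ga x -> pd Om i0 b x = 0) ->
  (forall x, Om x -> frob (grad Om b x) <= delta / chat) ->
  (forall x, Om x -> frob (hess Om b x) <= delta / chat ^+ 2) ->
  (forall x, W x -> mach Om gamma c0 chi x <= 1) ->
  (forall x, W x -> sound_speed Om gamma c0 chi x <= chat) ->
  ~ attains_max W (fun x => mach Om gamma c0 chi x ^+ 2 + b x).
Proof.
move=> d2 ch0 mu00 mu02 mum del0 delm bC2 bN db_le ddb_le mach_le c_le [x Wx Fx].
have [b_p bC1] := Ck_has_partials bC2.
have db_p j : has_partials Om W (pd Om j b) (fun i => pd Om i (pd Om j b)).
  by have [] := Ck_has_partials (bC1 j).
have sx := s_gt0 Wx.
have F_p := has_partialsD mach2_partials b_p.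
have dF_p j := has_partialsD (dmach2_partials j) (db_p j).
have [||crit nsd] := max_critical hs F_p dF_p Wx.
- by move=> y Wy; rewrite -!mach2E //; exact: Fx.
- by move=> Gx; rewrite dmach2_neumann // bN // addr0.
have Gs : \sum_i g i x ^+ 2 <= s x.
  have := mach_le x Wx; rewrite -(ler_pXn2r (n := 2)) ?nnegrE //; last first.
    by rewrite divr_ge0 ?frob_ge0 // sound_speedE // sqrtr_ge0.
  by rewrite mach2E // /jet_mach2 expr1n ler_pdivrMr // mul1r.
have [pde dpde] := flow_jet Wx.
have s_le : s x <= chat ^+ 2.
  rewrite -[s x]sqr_sqrtr ?(ltW sx) // ler_pXn2r ?nnegrE ?sqrtr_ge0 ?(ltW ch0) //.
  by rewrite -sound_speedE //; exact: c_le.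
apply: (jet_contradiction (ddb := fun i j => pd Om i (pd Om j b) x)
  d2 sx ch0 s_le mu00 mu02 mum del0 delm Gs
  (fun i j => H_sym i j Wx) (fun i j k => T_sym i j k Wx) pde dpde crit).
- exact: contract_le0.
- rewrite -subr_le0.
  apply: (le0_closure hs Wx
    (f := fun y => \sum_i pd Om i b y ^+ 2 - (delta / chat) ^+ 2)).
    apply: cvgB; last exact: cvg_cst.
    apply: cvg_sum_in => i; rewrite expr2; under eq_fun do rewrite expr2.
    have [_ /(_ i x Wx) c _] := b_p.
    by apply: cvgM.
  move=> y Oy; rewrite subr_le0.
  have := ler_pM (frob_ge0 _) (frob_ge0 _) (db_le y Oy) (db_le y Oy).
  by rewrite -!expr2 frob_row_sqr; under eq_bigr do rewrite mxE.
- rewrite -subr_le0.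
  apply: (le0_closure hs Wx (f := fun y =>
    \sum_i \sum_j pd Om i (pd Om j b) y ^+ 2 - (delta / chat ^+ 2) ^+ 2)).
    apply: cvgB; last exact: cvg_cst.
    apply: cvg_sum_in => i; apply: cvg_sum_in => j.
    rewrite expr2; under eq_fun do rewrite expr2.
    have [_ /(_ i x Wx) c _] := db_p j.
    by apply: cvgM.
  move=> y Oy; rewrite subr_le0.
  have := ler_pM (frob_ge0 _) (frob_ge0 _) (ddb_le y Oy) (ddb_le y Oy).
  rewrite -[X in X <= _]expr2 -[X in _ <= X]expr2 /frob sqr_sqrtr; last first.
    by apply: sumr_ge0 => i _; apply: sumr_ge0 => j _; exact: sqr_ge0.
  by under eq_bigr do under eq_bigr do rewrite mxE.
Qed.

End flow.

Theorem theorem2 (R : realType) (d : nat) (hd : (2 <= d)%N) (gamma : R)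
    (hgamma : -1 < gamma) (a : 'rV[R]_d) (r : R) (hr : 0 < r) :
  let i0 : 'I_d := Ordinal (ltnW hd) in
  let U := eball a r in
  let Omega := half_dom i0 U in
  let Gamma := flat_bdry i0 U in
  a 0 i0 = 0 ->
  exists2 delta : R, 0 < delta &
    forall (chat : R) (b chi : 'rV[R]_d -> R) (c0 rho0 : R),
      0 < chat -> 0 < c0 -> 0 < rho0 ->
      Ck Omega Gamma 2 b ->
      (forall x, Gamma x -> pd Omega i0 b x = 0) ->
      (forall x, Omega x -> frob (grad Omega b x) <= delta / chat) ->
      (forall x, Omega x -> frob (hess Omega b x) <= delta / chat ^+ 2) ->
      Ck Omega Gamma 3 chi ->
      (forall x, Omega x -> potential_flow Omega gamma c0 chi x) ->
      (forall x, Gamma x -> pd Omega i0 chi x = 0) ->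
      (forall x, (Omega `|` Gamma) x ->
        [/\ mach Omega gamma c0 chi x <= 1,
            positive_density Omega gamma c0 rho0 chi x &
            sound_speed Omega gamma c0 chi x <= chat]) ->
      (forall x, (Omega `|` Gamma) x ->
        mach Omega gamma c0 chi x ^+ 2 <= 1 - delta) \/
      ~ attains_max (Omega `|` Gamma)
          (fun x => mach Omega gamma c0 chi x ^+ 2 + b x).
Proof.
move=> i0 U Omega Gamma a0.
have hs : half_space_like i0 Omega Gamma by exact: half_ball_like.
(* The least value of 2 - (1 - gamma) N for N between 0 and 1, attained at an end
   point; it is positive because gamma > -1. *)
pose mu0 := Num.min 2 (1 + gamma).
have mu00 : 0 < mu0 by rewrite lt_min ltr0n /=; lra.
have K0 : 0 < 4 * (5 + 9 * `|1 - gamma|).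
  by have := normr_ge0 (1 - gamma); lra.
exists (mu0 / (4 * (5 + 9 * `|1 - gamma|))); first by rewrite divr_gt0.
move=> chat b chi c0 rho0 chat0 c00 rho00 bC2 bN db ddb chiC3 pde slip hyp.
right; apply: (mach2_perturbed_no_max hs c00 rho00 chiC3 _ pde slip hd chat0 mu00
  _ _ _ _ bC2 bN db ddb).
- by move=> x /hyp[].
- by rewrite ge_min lexx.
- by rewrite (_ : 2 - (1 - gamma) = 1 + gamma) ?ge_min ?lexx ?orbT //; ring.
- by rewrite divr_gt0.
- by rewrite divfK // gt_eqF.
- by move=> x /hyp[].
- by move=> x /hyp[].
Qed.
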